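(* Let $q\ge 4$ with $q\equiv 2$ or $4\pmod 6$. Then there exists a Steiner quadruple system on $B_q$ that satisfies the step property with respect to some total order on $B_q$.
   Context: $B_q=\{0,\dots,q-1\}$. A Steiner quadruple system $SQS(q)$ on $B_q$ is a set of 4-element subsets (quadruples) of $B_q$ such that every 3-element subset of $B_q$ is contained in exactly one quadruple. Step property: given a total order $L_0<L_1<\cdots<L_{q-1}$ on $B_q=\{L_0,\dots,L_{q-1}\}$ ($q$ even), the $SQS(q)$ satisfies the step property with respect to this order if for every $t\in\{0,\dots,q/2-1\}$ and every quadruple of the system of the form $\{L_{2t},L_{2t+1},L_a,L_b\}$, either $a<2t$ and $b<2t$, or $a>2t+1$ and $b>2t+1$. *)

(* Defs.v *)
From mathcomp Require Import all_boot all_fingroup.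
Set Implicit Arguments. Unset Strict Implicit. Unset Printing Implicit Defensive.

(* B_q is modelled as 'I_q = {0,...,q-1}. *)

Definition is_SQS (q : nat) (S : {set {set 'I_q}}) : Prop :=
  (forall Q, Q \in S -> #|Q| = 4) /\
  (forall T : {set 'I_q}, #|T| = 3 -> exists! Q, Q \in S /\ T \subset Q).

(* A total order L_0 < L_1 < ... < L_{q-1} on B_q is given by an enumeration
   L : {perm 'I_q}, with L_i := L i. *)
Definition step_property (q : nat) (S : {set {set 'I_q}}) (L : {perm 'I_q}) : Prop :=
  forall (t : nat) (Q : {set 'I_q}) (i j a b : 'I_q),
    t < q./2 -> val i = 2 * t -> val j = 2 * t + 1 ->
    Q \in S -> Q = [set L i; L j; L a; L b] ->
    #|Q| = 4 ->
    (a < 2 * t /\ b < 2 * t) \/ (2 * t + 1 < a /\ 2 * t + 1 < b).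

(* Main.v *)
(** A quadruple system is the same thing as a ternary operation [f] sending a triple to
    the fourth point of its block: [f] is symmetric, [f a a b = b] and [f a b] is an
    involution. Admissible orders are reached by recursion. Orders divisible by 4 are
    obtained by doubling. Orders 4(v-2)+2, 3(v-2)+2 and 3(v-4)+4 take copies of a system
    of order v that share their first one or two pairs (the stem), placed one after the
    other in the order; triples meeting two copies are completed by sum rules in Z_2n
    and one-factorizations. For a pair inside one copy the step property only forbids
    blocks whose other two points lie in an earlier and a later copy; in the tripling
    rules, pairs of antipodes avoid these. Orders 3(v-1)+1 and 12(v-1)+2 delete a point
    from a system of order v and inflate the other points by Z_3 and Z_12: blocks
    through the deleted point become an SQS(10), resp. a system on 3 * 12 + 2 points,
    and the remaining blocks become transversal designs. Together with an SQS(14) this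
    covers all residues modulo 72. *)

Require Import Defs.
From mathcomp Require Import all_boot all_algebra all_fingroup.
From mathcomp Require Import zify ring.

Set Implicit Arguments. Unset Strict Implicit. Unset Printing Implicit Defensive.

Import GRing.Theory.

(** The step property is both the goal and the fuel of the recursion. It forces positions 0, 1, 2, 3
    to form a block, since the block through 2, 3 and 0 must end below 2. Hence copies of a stepped
    system can share their first two or four points without any separate assumption on subsystems.

    The rules with a stem of two or four points keep each pair of the order inside the stem or one
    copy, which requires copies of even size. Inflation by Z_3 cannot do so: over a pair [{x, y}] of
    the inflated system its pairs are [{(x, i), (y, i)}], running across two copies. Their step
    property is inherited from the inflated system, thanks to an SQS(10) in which a block through
    such a pair either consists of two such pairs or has its other two points outside both copies.

    The interval form of tripling needs group and stem sizes that agree modulo 6. A group of 12 with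
    a stem of 2 is out of its reach, so that candelabra is built by hand. *)

Definition skein (T : Type) (f : T -> T -> T -> T) : Prop :=
  [/\ forall a b c, f a b c = f b a c,
      forall a b c, f a b c = f a c b,
      forall a b, f a a b = b &
      forall a b c, f a b (f a b c) = c].

(* The condition for [pos c > pos y] follows, since [f x y] is an involution. *)
Definition stepped (T : Type) (pos : T -> nat) (f : T -> T -> T -> T) : Prop :=
  forall x y c, ~~ odd (pos x) -> pos y = (pos x).+1 ->
    pos c < pos x -> pos (f x y c) < pos x.

Definition step_order (v : nat) : Prop :=
  exists f : 'I_v -> 'I_v -> 'I_v -> 'I_v, skein f /\ stepped (@nat_of_ord v) f.

Lemma skein_transport (T U : Type) (h : T -> U) (k : U -> T) f :
  cancel h k -> cancel k h -> skein f ->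
  skein (fun a b c => k (f (h a) (h b) (h c))).
Proof.
move=> hK kK [s1 s2 s3 s4]; split=> [a b c|a b c|a b|a b c] /=.
- by rewrite s1.
- by rewrite s2.
- by rewrite s3 hK.
- by rewrite kK s4 hK.
Qed.

(** * Orders carried by arbitrary finite types *)

Section Positions.

Variables (T : finType) (v : nat) (pos : T -> nat).
Hypotheses (cardT : #|T| = v) (pos_inj : injective pos) (pos_lt : forall x, pos x < v).

Let ordpos x := Ordinal (pos_lt x).

Let ordpos_bij : bijective ordpos.
Proof.
apply: inj_card_bij; last by rewrite card_ord cardT.
by move=> x y /(congr1 val) /= /pos_inj.
Qed.

Lemma step_order_on : step_order v -> exists f, skein f /\ stepped pos f.
Proof.
case=> f [fS fst]; case: ordpos_bij => k hK kK.
exists (fun a b c => k (f (ordpos a) (ordpos b) (ordpos c))); split.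
  exact: (skein_transport hK kK fS).
have posk z : pos (k z) = z by rewrite -[in RHS](kK z).
by move=> x y c ox yx cx; rewrite posk; apply: (fst (ordpos x)).
Qed.

Lemma step_order_of f : skein f -> stepped pos f -> step_order v.
Proof.
move=> fS fst; case: ordpos_bij => k hK kK.
exists (fun a b c => ordpos (f (k a) (k b) (k c))); split.
  exact: (skein_transport kK hK fS).
have posk z : pos (k z) = z by rewrite -[in RHS](kK z).
move=> x y c; rewrite -(posk x) -(posk y) -(posk c) => ox yx cx.
by rewrite (posk x) -[X in _ < X](posk x) /=; apply: (fst).
Qed.

End Positions.

(** * Skeins and their quadruple systems *)

Section SkeinTheory.

Variables (T : eqType) (f : T -> T -> T -> T).
Hypothesis fS : skein f.

Lemma skeinC12 a b c : f a b c = f b a c. Proof. by case: fS. Qed.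
Lemma skeinC23 a b c : f a b c = f a c b. Proof. by case: fS. Qed.
Lemma skeinC13 a b c : f a b c = f c b a.
Proof. by rewrite skeinC12 skeinC23 skeinC12. Qed.
Lemma skein12 a b : f a a b = b. Proof. by case: fS. Qed.
Lemma skein13 a b : f a b a = b. Proof. by rewrite skeinC23 skein12. Qed.
Lemma skein23 a b : f b a a = b. Proof. by rewrite skeinC12 skein13. Qed.
Lemma skeinK a b c : f a b (f a b c) = c. Proof. by case: fS. Qed.

Lemma skein_eq1 a b c : (f a b c == a) = (b == c).
Proof.
apply/eqP/eqP => [e|->]; last exact: skein23.
by rewrite -(skeinK a b c) e skein13.
Qed.
Lemma skein_eq2 a b c : (f a b c == b) = (a == c).
Proof. by rewrite skeinC12 skein_eq1. Qed.
Lemma skein_eq3 a b c : (f a b c == c) = (a == b).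
Proof. by rewrite skeinC23 skein_eq2. Qed.

(** The equations come as one tuple so that [rewrite] picks the ordering that occurs; together with
    [skein_block] this evaluates [f] on all ordered triples of a block. *)
Lemma skein_sym x y z w : f x y z = w ->
  ((f x y z = w) * (f y x z = w) * (f x z y = w) *
   (f y z x = w) * (f z x y = w) * (f z y x = w))%type.
Proof.
move=> <-; do !split; rewrite ?(skeinC12 y x) //; first by rewrite skeinC23.
- by rewrite (skeinC23 y) (skeinC12 y).
- by rewrite (skeinC12 z) (skeinC23 x z).
- by rewrite (skeinC13 z).
Qed.

Lemma skein_block x y z w : f x y z = w ->
  [/\ f x y w = z, f x z w = y & f y z w = x].
Proof.
move=> <-; split; first exact: skeinK.
  by rewrite (skeinC23 x y) skeinK.
by rewrite (skeinC12 x y) (skeinC23 y x) skeinK.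
Qed.

End SkeinTheory.

Lemma cards3P (T : finType) (A : {set T}) : #|A| = 3 ->
  exists a b c, [/\ a != b, a != c, b != c & A = [set a; b; c]].
Proof.
move=> A3; have /card_gt0P[a aA] : 0 < #|A| by rewrite A3.
have /eqP/cards2P[b [c [bc Abc]]] : #|A :\ a| = 2.
  by move: A3; rewrite (cardsD1 a) aA => -[].
have: b \in A :\ a by rewrite Abc !inE eqxx.
have: c \in A :\ a by rewrite Abc !inE eqxx orbT.
rewrite !inE => /andP[ca _] /andP[ba _].
exists a, b, c; split; rewrite // 1?eq_sym //.
by rewrite -(setD1K aA) Abc setUA.
Qed.

Lemma cards4 (T : finType) (x y z w : T) :
  #|[set x; y; z; w]| = (w \notin [set x; y; z]) + ((z \notin [set x; y]) + (x != y).+1).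
Proof. by rewrite setUC cardsU1; congr addn; rewrite setUC cardsU1 cards2. Qed.

(** The blocks are the sets [{a, b, c, f a b c}] with distinct [a], [b], [c]. Positions in
    [step_order] are the natural ones, so [L] is the identity permutation. *)
Lemma step_order_SQS q : step_order q ->
  exists (S : {set {set 'I_q}}) (L : {perm 'I_q}), is_SQS S /\ step_property S L.
Proof.
case=> f [fS fst].
pose blk (t : 'I_q * 'I_q * 'I_q) := [set t.1.1; t.1.2; t.2; f t.1.1 t.1.2 t.2].
pose dist (t : 'I_q * 'I_q * 'I_q) := [&& t.1.1 != t.1.2, t.1.1 != t.2 & t.1.2 != t.2].
pose S := [set blk t | t in dist].
(* Any three distinct points of a block give the block back, which is the uniqueness part of
   [is_SQS]. Each choice of three among the four points is settled by the table [fE]. *)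
have Sblk Q a b c : Q \in S -> a \in Q -> b \in Q -> c \in Q ->
    dist (a, b, c) -> Q = blk (a, b, c).
  case/imsetP=> [[[x y] z]] /and3P[/= xy xz yz] ->.
  rewrite /blk /= !inE.
  have fx : f x y z != x by rewrite (skein_eq1 fS).
  have fy : f x y z != y by rewrite (skein_eq2 fS).
  have fz : f x y z != z by rewrite (skein_eq3 fS).
  set w := f x y z in fx fy fz *.
  have [xyw xzw yzw] := skein_block fS (erefl w : f x y z = w).
  have fE := (skein_sym fS (erefl w : f x y z = w), skein_sym fS xyw,
              skein_sym fS xzw, skein_sym fS yzw).
  do 3![case/orP=> [/orP[/orP[]|]|] /eqP->];
    rewrite /dist /= ?eqxx /= ?andbF //= => _;
    rewrite ?fE;
    apply/setP=> t; rewrite !inE;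
    by case: (t == x); case: (t == y); case: (t == z); case: (t == w).
have card4 Q : Q \in S -> #|Q| = 4.
  case/imsetP=> [[[x y] z]] /and3P[/= xy xz yz] ->.
  rewrite /blk /= cards4 !inE.
  rewrite (skein_eq1 fS) (skein_eq2 fS) (skein_eq3 fS).
  by rewrite (eq_sym z x) (eq_sym z y) (negbTE xy) (negbTE xz) (negbTE yz).
exists S, 1%g; split; first split=> //.
  move=> U /cards3P[a [b [c [ab ac bc ->]]]].
  have dabc : dist (a, b, c) by rewrite /dist /= ab ac bc.
  exists (blk (a, b, c)); split.
    split; first by apply/imsetP; exists (a, b, c).
    by apply/subsetP=> t; rewrite !inE => /orP[/orP[]|] ->; rewrite ?orbT.
  move=> Q [QS /subsetP sub]; symmetry; apply: Sblk => //; apply: sub;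
    by rewrite !inE eqxx ?orbT.
move=> t Q i j a b _ it jt QS; rewrite !perm1 => Qe Q4.
have : dist (i, j, a) /\ dist (i, j, b).
  move: Q4; rewrite Qe cards4 !inE /dist /=.
  rewrite (eq_sym b i) (eq_sym b j) (eq_sym b a) (eq_sym a i) (eq_sym a j) !negb_or.
  by case: (i == j); case: (i == a); case: (j == a); case: (i == b);
     case: (j == b); case: (a == b).
case=> da db.
have inQ x : x \in [:: i; j; a; b] -> x \in Q.
  by rewrite Qe !inE => /or4P[] ->; rewrite ?orbT.
have low x y : dist (i, j, x) -> dist (i, j, y) -> x != y -> x \in Q -> y \in Q ->
    x < 2 * t -> y < 2 * t.
  move=> dx dy xy xQ yQ xt.
  have Qx : Q = blk (i, j, x) by apply: Sblk => //; apply: inQ; rewrite !inE eqxx ?orbT.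
  have : y = f i j x.
    move: yQ dx dy; rewrite Qx /blk /dist !inE /=.
    rewrite (eq_sym y i) (eq_sym y j) (eq_sym y x) (negbTE xy).
    by case: (i == y); case: (j == y); rewrite ?andbF //= => /eqP.
  move->; rewrite -it; apply: (fst i j x); rewrite ?it //; first by rewrite mul2n odd_double.
  by rewrite jt addn1.
have ab : a != b.
  apply/eqP=> ab; move: Q4; rewrite Qe ab cards4 !inE eqxx orbT /=.
  by case: (b == i); case: (b == j); case: (i == j).
have ge x : dist (i, j, x) -> 2 * t <= x -> 2 * t + 1 < x.
  move=> /and3P[_ /= ix jx] tx; move: it jt ix jx => /= it jt.
  by rewrite -!(inj_eq val_inj) /= it jt; lia.
(* If [a] is below the pair, [low] puts [b] below. If [a] is not, then [b] is not either, for [low]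
   with [a] and [b] exchanged would bring [a] down. *)
case: (ltnP a (2 * t)) => at_; [left|right].
  by split=> //; apply: (low a); rewrite ?inQ // !inE eqxx ?orbT.
split; apply: ge => //; rewrite leqNgt; apply/negP => bt.
by move: at_; rewrite leqNgt (low b a) // 1?eq_sym // inQ // !inE eqxx ?orbT.
Qed.

(* [g x y z] is the partner of [z] in the one-factor containing the edge [{x, y}]. *)
Definition one_factorization (T : Type) (g : T -> T -> T -> T) : Prop :=
  [/\ forall x y z, g x y z = g y x z,
      forall x y, g x y x = y,
      forall x z, g x x z = z &
      forall x y z t, g z (g x y z) t = g x y t].

(** * One-factorizations of complete graphs of even order *)

Section OneFactorizationTheory.

Variables (T : Type) (g : T -> T -> T -> T).
Hypothesis gO : one_factorization g.

Lemma ofacC x y z : g x y z = g y x z. Proof. by case: gO. Qed.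
Lemma ofac1 x y : g x y x = y. Proof. by case: gO. Qed.
Lemma ofac2 x y : g x y y = x. Proof. by rewrite ofacC ofac1. Qed.
Lemma ofacxx x z : g x x z = z. Proof. by case: gO. Qed.
Lemma ofac_edge x y z t : g z (g x y z) t = g x y t. Proof. by case: gO. Qed.
Lemma ofacK x y z : g x y (g x y z) = z.
Proof. by rewrite -(ofac_edge x y z (g x y z)) ofac2. Qed.

End OneFactorizationTheory.

Lemma one_factorization_transport (T U : Type) (h : T -> U) (k : U -> T) g :
  cancel h k -> cancel k h -> one_factorization g ->
  one_factorization (fun a b c => k (g (h a) (h b) (h c))).
Proof.
move=> hK kK gO; split=> [x y z|x y|x z|x y z t] /=.
- by rewrite ofacC.
- by rewrite ofac1.
- by rewrite ofacxx.
- by rewrite kK ofac_edge.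
Qed.

Section CyclicOneFactorization.

Local Open Scope ring_scope.

Variable j : nat.
Let G := 'I_j.*2.+1.

(** Twice [j.+1] is 1 modulo [j.*2.+1], so this multiple is the half of [x]. *)
Let half (x : G) : G := x *+ j.+1.

Let halfK x : half x + half x = x.
Proof.
rewrite /half -mulrnDr addnn doubleS Zp_mulrn; apply/val_inj => /=.
by rewrite mulnC mulSn -mulnC addnC modnMDl modn_small.
Qed.

Let double_inj (x y : G) : x + x = y + y -> x = y.
Proof.
have halfD (z : G) : half (z + z) = z.
  by rewrite -[RHS]halfK /half mulrnDl.
by move=> e; rewrite -(halfD x) e halfD.
Qed.

(** The round-robin factorization, with [None] as the point at infinity. At [a] the sums [a + b]
    with [b != a] miss only [a + a], which becomes the colour of the edge to infinity. *)
Let colour (x y : option G) : G :=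
  match x, y with
  | Some a, Some b => a + b
  | Some a, None | None, Some a => a + a
  | None, None => 0
  end.

Let partner (c : G) (z : option G) : option G :=
  if z is Some a then if c - a == a then None else Some (c - a) else Some (half c).

Let partnerE x y : x != y -> partner (colour x y) x = y.
Proof.
case: x y => [a|] [b|] //=.
- by rewrite [a + b]addrC addrK; case: (b =P a) => // ->; rewrite eqxx.
- by rewrite addrK eqxx.
- by move=> _; congr Some; apply: double_inj; rewrite halfK.
Qed.

Let partner_neq c z : partner c z != z.
Proof.
case: z => [a|] //=; case: (c - a =P a) => // n.
by apply/eqP=> -[].
Qed.

Let colour_partner c z : colour z (partner c z) = c.
Proof.
case: z => [a|] /=; last exact: halfK.
by case: eqP => [e|_] /=; [rewrite -{1}e subrK | rewrite addrC subrK].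
Qed.

Let ofac x y z := if x == y then z else partner (colour x y) z.

Lemma cyclic_one_factorization : exists g : option G -> _, one_factorization g.
Proof.
exists ofac; rewrite /ofac; split=> [x y z|x y|x z|x y z t].
- rewrite eq_sym; case: eqP => // _; congr partner.
  by case: x y => [a|] [b|] //=; rewrite addrC.
- by case: eqP => // /eqP; apply: partnerE.
- by rewrite eqxx.
- case: (x =P y) => [_|n]; first by rewrite eqxx.
  by rewrite eq_sym (negbTE (partner_neq _ _)) colour_partner.
Qed.

End CyclicOneFactorization.

Lemma one_factorization_exists (T : finType) :
  ~~ odd #|T| -> exists g : T -> T -> T -> T, one_factorization g.
Proof.
case: (posnP #|T|) => [T0 _|Tpos ev].
  by exists (fun _ _ z => z); split=> x; have := fintype0 x; rewrite T0 => /(_ erefl).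
have [j Tj] : exists j, #|T| = #|{: option 'I_j.*2.+1}|.
  by exists (#|T|.-1)./2; rewrite card_option card_ord; lia.
have [g gO] := cyclic_one_factorization j.
have [h [k hK kK]] : exists h : T -> option 'I_j.*2.+1, bijective h.
  exists (fun x => enum_val (cast_ord Tj (enum_rank x))).
  exists (fun y => enum_val (cast_ord (esym Tj) (enum_rank y))) => x.
  - by rewrite enum_valK cast_ordK enum_rankK.
  - by rewrite enum_valK cast_ordKV enum_rankK.
eexists; exact: (one_factorization_transport hK kK gO).
Qed.

(** Both copies carry the same [g]; a mixed block is an edge in each copy, both from one factor. The
    pairs of the new order are [{(x, false), (x, true)}]. An edge shares its factor with itself, so
    a block through such a pair is a union of two of them. *)
Theorem step_order_double v : ~~ odd v -> step_order v -> step_order v.*2.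
Proof.
move=> ev [f [fS _]].
have [g gO] : exists g : 'I_v -> _, one_factorization g.
  by apply: one_factorization_exists; rewrite card_ord.
pose pos (p : 'I_v * bool) := p.1.*2 + p.2.
pose F (p q r : 'I_v * bool) : 'I_v * bool :=
  if p.2 == q.2 then
    if q.2 == r.2 then (f p.1 q.1 r.1, r.2) else (g p.1 q.1 r.1, r.2)
  else if p.2 == r.2 then (g p.1 r.1 q.1, q.2) else (g q.1 r.1 p.1, p.2).
apply: (@step_order_of _ _ pos _ _ _ F).
- by rewrite card_prod card_ord card_bool muln2.
- move=> [x a] [y b]; rewrite /pos /= => e.
  have xy : x = y by apply/val_inj; case: a b e => [] [] /=; lia.
  by rewrite xy; case: a b e => [] [] //=; lia.
- by move=> [x b]; rewrite /pos /=; have := ltn_ord x; case: b => /=; lia.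
- split=> [[x a] [y b] [z c]|[x a] [y b] [z c]|[x a] [y b]|[x a] [y b] [z c]]; rewrite /F /=.
  + case: a b c => [] [] [] /=; congr pair;
      by [apply: skeinC12 fS _ _ _|apply: ofacC gO _ _ _|].
  + case: a b c => [] [] [] /=; congr pair;
      by [apply: skeinC23 fS _ _ _|apply: ofacC gO _ _ _|].
  + by case: a b => [] [] /=; rewrite ?(skein12 fS) ?(ofacxx gO).
  + by case: a b c => [] [] [] /=; rewrite ?(skeinK fS) ?(ofacK gO) ?(ofac_edge gO)
      ?(ofac1 gO) ?(ofac2 gO).
- move=> [x a] [y b] [z c]; rewrite /pos /= => ox yx.
  have [xy a0 b1] : [/\ x = y, a = false & b = true].
    by split; first apply/val_inj => /=; case: a b ox yx => [] [] /=; lia.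
  rewrite xy a0 b1 /F /=; case: c => /=; rewrite ?(ofac1 gO) ?(ofac2 gO); lia.
Qed.

(** * Candelabra systems and the filling of their groups *)

(* Points of a candelabra: a stem [S] and, for each index in [W], a copy of the group [G]. *)
Section Candelabra.

Variables (S G W : eqType).

Notation point := (S + W * G)%type.

Definition apart (a b : point) : bool :=
  match a, b with inr p, inr q => p.1 != q.1 | _, _ => false end.

Definition crossing (a b c : point) : bool := [|| apart a b, apart a c | apart b c].

(* A candelabra quadruple system, given by the fourth point of the block through a
   triple that meets two different groups. *)
Definition candelabra (h : point -> point -> point -> point) : Prop :=
  [/\ forall a b c, crossing a b c -> h a b c = h b a c,
      forall a b c, crossing a b c -> h a b c = h a c b,
      forall a b, apart a b -> h a a b = b &
      forall a b c, crossing a b c -> crossing a b (h a b c) /\ h a b (h a b c) = c].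

Lemma apartC a b : apart a b = apart b a.
Proof. by case: a b => [s|[x g]] [t|[y k]] //=; rewrite eq_sym. Qed.

Lemma apartxx a : apart a a = false.
Proof. by case: a => [s|[x g]] //=; rewrite eqxx. Qed.

Lemma crossing12 a b c : crossing a b c = crossing b a c.
Proof. by rewrite /crossing (apartC a b) [apart a c || _]orbC. Qed.

Lemma crossing23 a b c : crossing a b c = crossing a c b.
Proof. by rewrite /crossing (apartC b c) orbCA. Qed.

Definition to_group (w : W) (p : S + G) : point :=
  match p with inl s => inl s | inr g => inr (w, g) end.

Definition forget (a : point) : S + G :=
  match a with inl s => inl s | inr p => inr p.2 end.

Definition group_of (a : point) : option W := if a is inr p then Some p.1 else None.

Lemma to_groupK w : cancel (to_group w) forget.
Proof. by case. Qed.

Lemma crossing_to_group w p q r :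
  crossing (to_group w p) (to_group w q) (to_group w r) = false.
Proof. by rewrite /crossing; case: p q r => [?|?] [?|?] [?|?] /=; rewrite ?eqxx. Qed.

Lemma ncrossingP (w0 : W) a b c : ~~ crossing a b c ->
  exists w p q r, [/\ a = to_group w p, b = to_group w q & c = to_group w r].
Proof.
move=> nc; exists (odflt w0 (ohead (pmap group_of [:: a; b; c]))).
exists (forget a), (forget b), (forget c); move: nc.
by case: a b c => [s|[x g]] [t|[y k]] [u|[z l]] //=;
   rewrite /crossing ?negb_or //= ?negbK ?(orbF, andbT) => e;
   (try case/and3P: e => e e' _); (try move: e e' => /eqP-> /eqP->); (try move: e => /eqP->).
Qed.

Variables (h : point -> point -> point -> point) (f : S + G -> S + G -> S + G -> S + G).
Variable w0 : W.
Hypotheses (hC : candelabra h) (fS : skein f).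
Hypothesis stem_closed : forall r s t, exists u, f (inl r) (inl s) (inl t) = inl u.

(** A noncrossing triple lies in the stem and one group, found from its first argument outside the
    stem. A triple of stem points names no group and gets [w0]; by [stem_closed] all copies of [f]
    agree there, so the choice is harmless. *)
Definition fill a b c : point :=
  if crossing a b c then h a b c else
  to_group (odflt w0 (ohead (pmap group_of [:: a; b; c])))
    (f (forget a) (forget b) (forget c)).

Lemma fill_to_group w p q r :
  fill (to_group w p) (to_group w q) (to_group w r) = to_group w (f p q r).
Proof.
rewrite /fill crossing_to_group !to_groupK.
case: p q r => [s|g] [t|k] [u|l] //=.
by have [x ->] := stem_closed s t u.
Qed.

Lemma fill_crossing a b c : crossing a b c -> fill a b c = h a b c.
Proof. by rewrite /fill => ->. Qed.

Lemma fill_skein : skein fill.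
Proof.
have [h1 h2 h3 h4] := hC.
split=> [a b c|a b c|a b|a b c].
- case cr: (crossing a b c).
    have cr' := cr; rewrite crossing12 in cr'.
    by rewrite (fill_crossing cr) (fill_crossing cr') h1.
  have [w [p [q [r [-> -> ->]]]]] := ncrossingP w0 (negbT cr).
  by rewrite !fill_to_group (skeinC12 fS).
- case cr: (crossing a b c).
    have cr' := cr; rewrite crossing23 in cr'.
    by rewrite (fill_crossing cr) (fill_crossing cr') h2.
  have [w [p [q [r [-> -> ->]]]]] := ncrossingP w0 (negbT cr).
  by rewrite !fill_to_group (skeinC23 fS).
- case cr: (crossing a a b).
    by rewrite fill_crossing // h3 //; move: cr; rewrite /crossing apartxx /= orbb.
  have [w [p [q [r [-> e ->]]]]] := ncrossingP w0 (negbT cr).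
  by rewrite !fill_to_group (skein12 fS).
- case cr: (crossing a b c).
    by have [cr' e] := h4 _ _ _ cr; rewrite (fill_crossing cr) fill_crossing.
  have [w [p [q [r [-> -> ->]]]]] := ncrossingP w0 (negbT cr).
  by rewrite !fill_to_group (skeinK fS).
Qed.

End Candelabra.

(** With a third point in the stem or in group [w] itself, the filling system decides; only third
    points in an earlier group put a condition on [h]. *)
Definition stepped_candelabra (S G W : eqType) (posG : G -> nat) (posW : W -> nat)
    (h : S + W * G -> S + W * G -> S + W * G -> S + W * G) : Prop :=
  forall w x y p, ~~ odd (posG x) -> posG y = (posG x).+1 -> posW p.1 < posW w ->
    exists2 q, h (inr (w, x)) (inr (w, y)) (inr p) = inr q & posW q.1 < posW w.

(** * The step property of a filled candelabra *)

Section FillStep.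

Variables (S G W : finType) (nS nG nW : nat).
Hypotheses (cardS : #|S| = nS) (cardG : #|G| = nG) (cardW : #|W| = nW).
Variables (posS : S -> nat) (posG : G -> nat) (posW : W -> nat).
Hypotheses (posS_inj : injective posS) (posS_lt : forall s, posS s < nS).
Hypotheses (posG_inj : injective posG) (posG_lt : forall g, posG g < nG).
Hypotheses (posW_inj : injective posW) (posW_lt : forall w, posW w < nW).
Hypotheses (evS : ~~ odd nS) (evG : ~~ odd nG) (Wpos : 0 < nW).
Hypothesis nS24 : (nS == 2) || (nS == 4).
Variable h : S + W * G -> S + W * G -> S + W * G -> S + W * G.
Hypotheses (hC : candelabra h) (hst : stepped_candelabra posG posW h).

Let posSG (p : S + G) : nat := match p with inl s => posS s | inr g => nS + posG g end.

(* The first pair, resp. the first two pairs, form a subsystem. *)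
Let stem_closed f : skein f -> stepped posSG f ->
  forall r s t, exists u, f (inl r) (inl s) (inl t) = inl u.
Proof.
move=> fS fst r s t.
case: (altP (r =P s)) => [->|rs]; first by rewrite (skein12 fS); exists t.
case: (altP (r =P t)) => [->|rt]; first by rewrite (skein13 fS); exists s.
case: (altP (s =P t)) => [->|st]; first by rewrite (skein23 fS); exists r.
have nrs : posS r <> posS s by move/posS_inj/eqP; apply/negP.
have nrt : posS r <> posS t by move/posS_inj/eqP; apply/negP.
have nst : posS s <> posS t by move/posS_inj/eqP; apply/negP.
have [[ltr lts] ltt] := (posS_lt r, posS_lt s, posS_lt t).
case/orP: nS24 => /eqP S24; first by exfalso; lia.
rewrite S24 in ltr lts ltt.
have surjS i : i < 4 -> exists s, posS s = i.
  move=> i4; have pS4 u : posS u < 4 by rewrite -S24.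
  pose ord u := Ordinal (pS4 u).
  have ord_inj : injective ord by move=> x y /(congr1 val) /posS_inj.
  have /codomP[u /(congr1 val) /= ->] : Ordinal i4 \in codom ord.
    by apply: inj_card_onto; rewrite ?card_ord ?cardS ?S24.
  by exists u.
have [[[[a pa] [b pb]] [c pc]] [d pd]] :=
  (surjS 0 isT, surjS 1 isT, surjS 2 isT, surjS 3 isT).
(* The pair [{c, d}] has positions 2 and 3 and [a] precedes it, so the fourth point precedes it as
   well; it differs from [a], hence is [b]. The stem is therefore a block. *)
have ab : f (inl c) (inl d) (inl a) = inl b.
  have := fst (inl c) (inl d) (inl a); rewrite /= pa pc pd => /(_ isT erefl isT).
  case E: (f _ _ _) => [u|u] /=; last by rewrite S24; lia.
  move=> u2; congr inl; apply: posS_inj; rewrite pb.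
  suff: posS u <> 0 by move: u2; lia.
  rewrite -pa => /posS_inj ua; have: f (inl c) (inl d) (inl a) == inl a by rewrite E ua.
  rewrite (skein_eq3 fS) => /eqP [] cd; by move: pc; rewrite cd pd.
have abs u : [|| u == a, u == b, u == c | u == d].
  have : posS u < 4 by rewrite -S24.
  rewrite -!(inj_eq posS_inj) pa pb pc pd; lia.
have [cdb cab dab] := skein_block fS ab.
have fE := (skein_sym fS ab, skein_sym fS cdb, skein_sym fS cab, skein_sym fS dab).
move: rs rt st.
by case/or4P: (abs r) => /eqP->; case/or4P: (abs s) => /eqP->; case/or4P: (abs t) => /eqP->;
   rewrite ?eqxx // fE; eexists.
Qed.

Theorem step_order_fill : step_order (nS + nG) -> step_order (nS + nW * nG).
Proof.
move=> sSG.
have [f [fS fst]] : exists f, skein f /\ stepped posSG f.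
  apply: step_order_on sSG; first by rewrite card_sum cardS cardG.
    move=> [s|g] [t|k] /=.
    - by move/posS_inj->.
    - by move=> e; have := posS_lt s; rewrite e ltnNge leq_addr.
    - by move=> e; have := posS_lt t; rewrite -e ltnNge leq_addr.
    - by move/addnI/posG_inj->.
  by move=> [s|g] /=; [have := posS_lt s | have := posG_lt g]; lia.
have /card_gt0P[w0 _] : 0 < #|W| by rewrite cardW.
(* The stem comes first, then the groups in the order of [posW]. Since [nS] and [nG] are even, no
   pair of the order straddles two of these pieces. *)
pose pos (a : S + W * G) : nat :=
  match a with inl s => posS s | inr p => nS + (posW p.1 * nG + posG p.2) end.
have divG w g : (posW w * nG + posG g) %/ nG = posW w.
  have gG := posG_lt g.
  by rewrite divnMDl ?(divn_small gG) ?addn0 //; apply: leq_ltn_trans gG.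
have modG w g : (posW w * nG + posG g) %% nG = posG g.
  by rewrite modnMDl modn_small.
have lex w x w' y : posW w < posW w' ->
    posW w * nG + posG x < posW w' * nG + posG y.
  move=> ww'; rewrite ltnNge; apply/negP => /(leq_div2r nG).
  by rewrite !divG leqNgt ww'.
apply: (@step_order_of _ _ pos _ _ _ (fill h f w0)).
- by rewrite card_sum card_prod cardS cardG cardW.
- move=> [s|[w g]] [t|[w' k]] /=.
  + by move/posS_inj->.
  + by move=> e; have := posS_lt s; rewrite e ltnNge leq_addr.
  + by move=> e; have := posS_lt t; rewrite -e ltnNge leq_addr.
  + move/addnI => e; move: (congr1 (divn^~ nG) e) (congr1 (modn^~ nG) e).
    by rewrite !divG !modG => /posW_inj-> /posG_inj->.
- move=> [s|[w g]] /=; first by have := posS_lt s; lia.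
  rewrite ltn_add2l; have := posW_lt w; have := posG_lt g => gG wW.
  apply: (@leq_trans ((posW w).+1 * nG)); last by rewrite leq_mul2r wW orbT.
  by rewrite mulSn addnC ltn_add2r.
- exact: fill_skein hC fS (stem_closed fS fst).
have Sclosed := stem_closed fS fst.
move=> [s|[w x]] b c ev eb lt.
  have [t bt] : exists t, b = inl t.
    case: b eb => [t|[w' y]] /= eb; first by exists t.
    by have := posS_lt s; move: ev eb evS => /=; lia.
  case: c lt => [u|[w' z]] /= lt; last by have := posS_lt s; lia.
  have [y fy] := Sclosed s t u.
  move: eb; rewrite bt => /= eb.
  have := fill_to_group h w0 Sclosed w0 (inl s) (inl t) (inl u); rewrite /= => ->.
  have := fst (inl s) (inl t) (inl u); rewrite fy /=; exact.
move: ev eb lt; rewrite /= !oddD oddM (negbTE evS) (negbTE evG) andbF /= => ev.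
case: b => [t|[w' y]] /= eb; first by have := posS_lt t; lia.
have {}eb : posW w' * nG + posG y = (posW w * nG + posG x).+1 by lia.
have xG : (posG x).+1 < nG by have := posG_lt x; move: ev evG; lia.
have [ww' yx] : w' = w /\ posG y = (posG x).+1.
  split.
    apply: posW_inj; rewrite -(divG w' y) eb -addnS divnMDl; last by lia.
    by rewrite divn_small // addn0.
  by rewrite -(modG w' y) eb -addnS modnMDl modn_small.
rewrite ww' => lt.
case: c lt => [u|[w3 z]] /= lt.
  have := fill_to_group h w0 Sclosed w (inr x) (inr y) (inl u); rewrite /= => ->.
  have := fst (inr x) (inr y) (inl u); rewrite /= oddD (negbTE evS) ev yx addnS => /(_ isT erefl).
  have := posS_lt u => uS /(_ (ltn_addr _ uS)).
  case: (f _ _ _) => [r|r] /=; first by have := posS_lt r; lia.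
  by rewrite ltn_add2l => rx; rewrite ltn_add2l ltn_add2l.
case: (altP (w3 =P w)) => [w3w|w3w].
  rewrite w3w in lt *.
  have := fill_to_group h w0 Sclosed w (inr x) (inr y) (inr z); rewrite /= => ->.
  have := fst (inr x) (inr y) (inr z); rewrite /= oddD (negbTE evS) ev yx addnS => /(_ isT erefl).
  rewrite ltn_add2l; have zx : posG z < posG x by lia.
  move=> /(_ zx).
  case: (f _ _ _) => [r|r] /=; first by have := posS_lt r; lia.
  by rewrite ltn_add2l => rx; rewrite ltn_add2l ltn_add2l.
(* The third point is now in another group, which must be an earlier one: by [lex] a later group
   would place it after the pair. *)
rewrite fill_crossing; last by rewrite /crossing /= eqxx eq_sym w3w.
have w3lt : posW (w3, z).1 < posW w.
  rewrite /= ltn_neqAle (inj_eq posW_inj) w3w leqNgt; apply/negP => /(lex _ x _ z).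
  by move: lt; lia.
have [q -> lq] := hst ev yx w3lt.
by rewrite /= ltn_add2l lex.
Qed.

End FillStep.

(** * Halving in cyclic groups of even order *)

Section EvenCyclic.

Local Open Scope ring_scope.

Variables (k n : nat).
Hypothesis kn : (k.+2 = n.*2)%N.
Implicit Types x y z : 'I_k.+2.

Definition antipode : 'I_k.+2 := inZp n.
Definition half x : 'I_k.+2 := inZp x./2.
(** An even element has two halves, differing by the antipode. [upper] separates them, so that they
    can be shared out between two stem points. *)
Definition upper x : bool := (n <= x)%N.

Let ev_mod m : odd (m %% k.+2) = odd m.
Proof. by rewrite odd_mod // kn odd_double. Qed.

Lemma val_ordD x y : (x + y)%R = ((x + y) %% k.+2)%N :> nat.
Proof. by []. Qed.

Lemma odd_ordD x y : odd (x + y)%R = odd x (+) odd y.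
Proof. by rewrite ev_mod oddD. Qed.

Lemma odd_ordN x : odd (- x)%R = odd x.
Proof.
have := odd_ordD x (- x); rewrite subrr /=.
by case: (odd x); case: (odd (- x)%R).
Qed.

Lemma val_antipode : antipode = n :> nat.
Proof. by rewrite /= modn_small // kn -addnn; lia. Qed.

Lemma antipodeD : antipode + antipode = 0.
Proof. by apply/ord_inj; rewrite val_ordD val_antipode addnn -kn modnn. Qed.

Lemma antipodeN : - antipode = antipode.
Proof. by apply/eqP; rewrite eq_sym -addr_eq0 antipodeD. Qed.

Lemma halfK x : ~~ odd x -> half x + half x = x.
Proof.
move=> ox; apply/ord_inj => /=; rewrite modnDm addnn even_halfK //.
by rewrite modn_small.
Qed.

Lemma double_eq0 x : x + x = 0 -> x = 0 \/ x = antipode.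
Proof.
move/(congr1 (@nat_of_ord _)); rewrite val_ordD.
have xn : (x < n.*2)%N by rewrite -kn.
case: (ltnP x n) => xn' xx0; [left|right]; apply/ord_inj; rewrite ?val_antipode //=.
  by rewrite modn_small ?kn /= in xx0; lia.
have : (x + x = (x + x - n.*2) + n.*2)%N by lia.
by move=> e; rewrite e -kn modnDr modn_small ?kn /= in xx0; lia.
Qed.

Lemma double_eq x y : x + x = y + y -> x = y \/ x = y + antipode.
Proof.
move=> e; have [||] := @double_eq0 (x - y).
- by rewrite addrACA -opprD e subrr.
- by move/subr0_eq; left.
- by move=> <-; right; rewrite addrC subrK.
Qed.

Lemma upperD x : upper (x + antipode) = ~~ upper x.
Proof.
rewrite /upper val_ordD val_antipode.
have xn : (x < n.*2)%N by rewrite -kn.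
 case: (ltnP x n) => xn'; first by rewrite modn_small ?kn; lia.
have -> : (x + n = (x - n) + n.*2)%N by lia.
by rewrite -kn modnDr modn_small ?kn; lia.
Qed.

End EvenCyclic.

(** * Four groups and a stem of two points *)

Section Quadrupling.

Local Open Scope ring_scope.

Variables (k n : nat).
Hypothesis kn : (k.+2 = n.*2)%N.
Let G := 'I_k.+2.
Variable g : G -> G -> G -> G.
Hypothesis gO : one_factorization g.

Let W := (bool * bool)%type.
Let point := (bool + W * G)%type.
Implicit Types (i j : W) (x y z : G) (l : bool).

Let mate i : W := (i.1, ~~ i.2).

(* Two groups [(b, _)] form a side. If [p], [q] lie in the two groups of one side and
   [z], [z'] in group [j] of the other, then [{p, q, z, z'}] is a block iff
   [z + z' = p + q + shift j]; when [z = z'] the fourth point is in the stem instead. *)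
Let shift j : G := match j with (false, true) => -1 | (true, true) => 1 | _ => 0 end.

(** The first point is taken on side [false], the second on side [true]. When one of them is the
    apex of a stem block, meaning the doubled point [z = z'], exchanging the other for its partner
    in the mate group leaves [gap] unchanged. This dictates the offset 1 and the opposite signs in
    [shift]. *)
Let gap (c : bool) x (d : bool) z : G :=
  if c == d then if c then x - z + 1 else x - z else z - x.

(** Of two points on opposite sides either can be the apex of a stem block through both; [label] is
    the stem point of the block with apex [(j, z)]. By [label_swap] the two blocks get different
    stem points, so each stem point completes the pair exactly once. *)
Let label j z i x : bool :=
  if j.1 then upper n (gap i.2 x j.2 z) else ~~ upper n (gap j.2 z i.2 x).

Let label_swap i j x z : i.1 != j.1 -> label i x j z = ~~ label j z i x.
Proof. by case: i j => [[] c] [[] d] //= _; rewrite /label /= ?negbK. Qed.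

Let label_mate i j x y z : i.1 != j.1 -> z + z = x + y + shift j ->
  label j z i x = label j z (mate i) y.
Proof.
move=> ij e; have -> : x = z + z - y - shift j by rewrite e; ring.
by case: i j ij {e} => [[] []] [[] []] //= _; rewrite /label /gap /shift /=;
  (try congr negb); congr upper; ring.
Qed.

Let label_antipode i j x z : label j (z + antipode k n) i x = ~~ label j z i x.
Proof.
have gap1 c w d t : gap c (w + antipode k n) d t = gap c w d t + antipode k n.
  rewrite /gap; case: c d => [] [] /=; rewrite ?opprD ?(antipodeN kn); ring.
have gap2 c w d t : gap c w d (t + antipode k n) = gap c w d t + antipode k n.
  rewrite /gap; case: c d => [] [] /=; rewrite ?opprD ?(antipodeN kn); ring.
by rewrite /label gap1 gap2 !(upperD kn); case: j.1.
Qed.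

Let shift_odd j : odd (shift j) = j.2.
Proof. by case: j => [[] []] //; rewrite /shift (odd_ordN kn). Qed.

(** For points in mate groups, [shift j] is odd exactly when [j.2] holds, so the parity of [x + y]
    selects the group in which halving is possible. The two halves have opposite labels by
    [label_antipode], and [l] selects one. *)
Let apex l i x y : W * G :=
  let j := (~~ i.1, odd (x + y)%R) in
  let z := half (x + y + shift j) in
  (j, if label j z i x == l then z else z + antipode k n).

Let apexP l i x y : exists j z, [/\ apex l i x y = (j, z), j.1 = ~~ i.1,
  z + z = x + y + shift j & label j z i x = l].
Proof.
pose j : W := (~~ i.1, odd (x + y)%R); pose z := half (x + y + shift j).
have zz : z + z = x + y + shift j.
  by rewrite /z halfK // (odd_ordD kn) shift_odd addbb.
exists j, (if label j z i x == l then z else z + antipode k n); split=> //.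
  by case: ifP => // _; rewrite addrACA (antipodeD kn) addr0.
case: eqP => // ne; rewrite label_antipode.
by move: ne; case: (label j z i x) l => [] [].
Qed.

Let apex_uniq l i j x y z : j.1 = ~~ i.1 -> z + z = x + y + shift j ->
  label j z i x = l -> apex l i x y = (j, z).
Proof.
move=> ji zz lz; have [j' [z' [-> ji' zz' lz']]] := apexP l i x y.
have jj : j' = j.
  have par a w : w + w = x + y + shift a -> a.2 = odd (x + y)%R.
    move=> /(congr1 (fun t : G => odd t)).
    rewrite (odd_ordD kn w) addbb (odd_ordD kn (x + y)) shift_odd.
    by case: (odd _); case: a.2.
  rewrite [j']surjective_pairing [j]surjective_pairing ji ji'.
  by rewrite (par _ _ zz) (par _ _ zz').
rewrite jj in zz' lz' *; congr pair.
have [//|zz0] := double_eq kn (etrans zz' (esym zz)).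
by move: lz'; rewrite zz0 label_antipode lz; case: l {lz}.
Qed.

Let apexC l i x y : apex l i x y = apex l (mate i) y x.
Proof.
have [j [z [-> ji zz lz]]] := apexP l i x y.
apply/esym/apex_uniq => //.
  by rewrite zz [x + y]addrC.
by rewrite -lz; apply/esym/label_mate => //; rewrite ji; case: i.1.
Qed.

Let two i x y j z : point :=
  if i.1 == j.1 then inr (j, g x y z) else
  if x == y then inr (j, z) else inr (mate j, x + y - shift i - z).

Let one i x y j z : point :=
  let z' := x + y + shift j - z in
  if z' == z then inl (label j z i x) else inr (j, z').

Let stem l i x j y : point :=
  if i.1 == j.1 then inr (apex l i x y) else
  if label i x j y == l then inr (mate j, x + x - shift i - y)
  else inr (mate i, y + y - shift j - x).

Definition quadrupling (a b c : bool + (bool * bool) * 'I_k.+2) :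
    bool + (bool * bool) * 'I_k.+2 :=
  match a, b, c with
  | inr (i, x), inr (j, y), inr (m, z) =>
    if i == j then two i x y m z else if i == m then two i x z j y else
    if j == m then two j y z i x else
    if i.1 == j.1 then one i x y m z else if i.1 == m.1 then one i x z j y
    else one j y z i x
  | inl l, inr (i, x), inr (j, y)
  | inr (i, x), inl l, inr (j, y)
  | inr (i, x), inr (j, y), inl l => stem l i x j y
  | _, _, _ => a
  end.

Let twoC i x y j z : two i x y j z = two i y x j z.
Proof. by rewrite /two (ofacC gO) (eq_sym x) [x + y]addrC. Qed.

Let oneC i x y j z : i.1 != j.1 -> one i x y j z = one (mate i) y x j z.
Proof.
move=> ij; rewrite /one [x + y]addrC; case: eqP => // e.
congr inl; apply: label_mate => //.
by rewrite -{1}e; ring.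
Qed.

Let stemC l i x j y : i != j -> stem l i x j y = stem l j y i x.
Proof.
move=> ij; rewrite /stem eq_sym; case: eqP => e.
  have -> : j = mate i by case: i j ij e => [[] []] [[] []].
  by rewrite -apexC.
rewrite (@label_swap i j) //; last by apply/eqP; case: i.1 j.1 e => [] [].
by case: (label j y i x) l => [] [].
Qed.

Let quad12 a b c : crossing a b c -> quadrupling a b c = quadrupling b a c.
Proof.
case: a b c => [l|[i x]] [l'|[j y]] [l''|[m z]] //=; rewrite /crossing /= ?orbF ?andbT //.
- by apply: stemC.
- by case: i j m => [[] []] [[] []] [[] []] //= _; first [exact: twoC | exact: oneC].
Qed.

Let quad23 a b c : crossing a b c -> quadrupling a b c = quadrupling a c b.
Proof.
case: a b c => [l|[i x]] [l'|[j y]] [l''|[m z]] //=; rewrite /crossing /= ?orbF ?andbT //.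
- by apply: stemC.
- by case: i j m => [[] []] [[] []] [[] []] //= _; first [exact: twoC | exact: oneC].
Qed.

Let mateP i j : i.1 = j.1 -> i != j -> j = mate i.
Proof. by case: i j => [[] []] [[] []]. Qed.

Let sideN i j : i.1 != j.1 -> j.1 = ~~ i.1.
Proof. by case: i j => [[] c] [[] d]. Qed.

Let side_neq i j : i.1 != j.1 -> (i == j) = false.
Proof. by case: i j => [[] c] [[] d]. Qed.

Let mate_neq i : (i == mate i) = false.
Proof. by case: i => [[] []]. Qed.

Let mateK i : mate (mate i) = i.
Proof. by case: i => [c []]. Qed.

Let quad_one i x y j z : i.1 != j.1 ->
  quadrupling (inr (i, x)) (inr (mate i, y)) (inr (j, z)) = one i x y j z.
Proof.
by move=> ij; rewrite /quadrupling mate_neq (side_neq ij) (@side_neq (mate i)) // eqxx.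
Qed.

Let quad_one' i x y j z : i.1 != j.1 ->
  quadrupling (inr (i, x)) (inr (j, z)) (inr (mate i, y)) = one i x y j z.
Proof.
move=> ij; rewrite /quadrupling mate_neq (side_neq ij) (negbTE ij) eqxx.
by rewrite eq_sym (@side_neq (mate i)).
Qed.

Let quad_two' i x j y z : i != j ->
  quadrupling (inr (i, x)) (inr (j, y)) (inr (j, z)) = two j y z i x.
Proof. by move=> ij; rewrite /quadrupling (negbTE ij) eqxx. Qed.

Let stem_stem l i x j y : i != j ->
  quadrupling (inr (i, x)) (inr (j, y)) (stem l i x j y) = inl l.
Proof.
have opp l' i' x' j' y' : label i' x' j' y' = l' ->
    one j' y' (x' + x' - shift i' - y') i' x' = inl l'.
  by move=> <-; rewrite /one (_ : _ - x' = x') ?eqxx //; ring.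
rewrite /stem; case: (altP (i.1 =P j.1)) => [s ij|s ij].
  have [m [z [-> mi zz <-]]] := apexP l i x y.
  rewrite (mateP s ij) quad_one /one ?mi; last by case: i.1.
  by rewrite (_ : _ - z = z) ?eqxx // -zz addrK.
case: eqP => l0.
  rewrite quad12; last by rewrite /crossing /= ij.
  by rewrite quad_one' 1?eq_sym //; apply: opp.
rewrite quad_one' //; apply: opp.
by move: l0; rewrite label_swap //; case: (label _ _ _ _) l => [] [].
Qed.

Let stemK l i x j y : i != j ->
  exists m z, [/\ stem l i x j y = inr (m, z), i != m & stem l i x m z = inr (j, y)].
Proof.
rewrite {1}/stem; case: (altP (i.1 =P j.1)) => [s ij|s ij].
  have [m [z [-> mi zz lz]]] := apexP l i x y; exists m, z.
  have im : i.1 != m.1 by rewrite mi; case: i.1.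
  rewrite (side_neq im) /stem (negbTE im) label_swap // lz.
  rewrite (_ : _ == l = false); last by case: l {lz}.
  by split=> //; rewrite -(mateP s ij) zz; congr (inr (_, _)); ring.
case: eqP => l0.
  exists (mate j), (x + x - shift i - y).
  rewrite (@side_neq i (mate j)) // /stem (negbTE s).
  rewrite -(@label_mate j i y _ x) 1?eq_sym //; last by ring.
  by rewrite l0 eqxx mateK; split=> //; congr (inr (_, _)); ring.
exists (mate i), (y + y - shift j - x); rewrite mate_neq; split=> //.
rewrite /stem eqxx; congr inr; apply: apex_uniq; first exact: sideN.
  by ring.
by move: l0; rewrite label_swap //; case: (label _ _ _ _) l => [] [].
Qed.

Let twoK i x y j z : i != j ->
  exists m t, [/\ two i x y j z = inr (m, t), i != m & two i x y m t = inr (j, z)].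
Proof.
rewrite {1}/two; case: (altP (i.1 =P j.1)) => [s ij|s ij].
  by exists j, (g x y z); rewrite /two s eqxx (ofacK gO).
case: (altP (x =P y)) => [xy|xy].
  by exists j, z; rewrite /two (negbTE s) xy eqxx.
exists (mate j), (x + y - shift i - z); rewrite (@side_neq i (mate j)) //; split=> //.
by rewrite /two (negbTE s) (negbTE xy) mateK; congr (inr (_, _)); ring.
Qed.

Let two_apart i x z j y : i != j ->
  quadrupling (inr (i, x)) (inr (j, y)) (two i x z j y) = inr (i, z).
Proof.
rewrite /two; case: (altP (i.1 =P j.1)) => [s ij|s ij].
  by rewrite quad_two' // /two s eqxx (ofac_edge gO) (ofac1 gO).
case: (altP (x =P z)) => [xz|xz].
  by rewrite quad_two' // /two eq_sym (negbTE s) eqxx xz.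
rewrite quad12; last by rewrite /crossing /= ij.
rewrite quad_one' 1?eq_sym //.
rewrite /one (_ : _ - x = z); last by ring.
by rewrite eq_sym (negbTE xz).
Qed.

Let one_third i x y j z : i.1 != j.1 ->
  quadrupling (inr (i, x)) (inr (mate i, y)) (one i x y j z) = inr (j, z).
Proof.
move=> s; rewrite /one; case: eqP => e.
  rewrite /quadrupling /stem eqxx; congr inr; apply: apex_uniq => //; first exact: sideN.
  by rewrite -{1}e; ring.
rewrite quad_one // /one (_ : _ - (_ - z) = z); last by ring.
by case: eqP => // e'; case: e.
Qed.

Let one_first i x z j y : i.1 != j.1 ->
  quadrupling (inr (i, x)) (inr (j, y)) (one i x z j y) = inr (mate i, z).
Proof.
move=> s; rewrite /one; case: eqP => e.
  rewrite /quadrupling /stem (negbTE s) (label_swap _ _ s).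
  rewrite (_ : _ == _ = false); last by case: (label _ _ _ _).
  by congr (inr (_, _)); rewrite -{1}e; ring.
rewrite quad_two' ?(side_neq s) // /two eq_sym (negbTE s) eq_sym.
by case: eqP => // _; congr (inr (_, _)); ring.
Qed.

Let quad_apart a b c : apart a b -> quadrupling a b (quadrupling a b c) = c.
Proof.
case: a b => [l|[i x]] [l'|[j y]] // ij; rewrite /apart /= in ij.
case: c => [l|[m z]]; first exact: stem_stem.
have cr c' : crossing (inr (i, x)) (inr (j, y)) c' by rewrite /crossing /= ij.
rewrite [X in quadrupling _ _ X]/quadrupling (negbTE ij).
case: (altP (i =P m)) => [<-|im]; first exact: two_apart.
case: (altP (j =P m)) => [<-|jm].
  by rewrite quad12 // two_apart 1?eq_sym.
case: (altP (i.1 =P j.1)) => [s|s].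
  have mi : i.1 != m.1.
    by move: ij im jm s; case: i j m {cr} => [[] []] [[] []] [[] []].
  by rewrite (mateP s ij) one_third.
case: (altP (i.1 =P m.1)) => [s'|s'].
  by rewrite one_first // (mateP s' im).
have jm' : j.1 = m.1 by case: i.1 j.1 m.1 s s' => [] [] [].
by rewrite quad12 // one_first 1?eq_sym // (mateP jm' jm).
Qed.

Lemma quadrupling_candelabra : candelabra quadrupling.
Proof.
split; [exact: quad12 | exact: quad23 | |].
  case=> [l|[i x]] [l'|[j y]] //= ij.
  rewrite /quadrupling eqxx /two eqxx (ofacxx gO).
  by case: ifP.
move=> a b c cr; case ab: (apart a b).
  by rewrite quad_apart // /crossing ab.
case: a b c cr ab => [l|[i x]] [l'|[j y]] [l''|[m z]]; rewrite /crossing /= ?orbF // => cr.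
- by move=> _; have [m' [z' [-> jm e]]] := stemK l y z cr; rewrite /= jm.
- by move=> _; have [m' [z' [-> im e]]] := stemK l' x z cr; rewrite /= im.
- by rewrite cr.
- move/negbFE/eqP => ij; rewrite -ij eqxx /= in cr *.
  rewrite orbb in cr.
  by have [m' [z' [-> im e]]] := twoK x y z cr; rewrite /= im.
Qed.

(** The two groups of a side are consecutive in the order, so if a group of the other side is
    earlier, so is its mate. *)
Lemma quadrupling_stepped (posG : G -> nat) :
  stepped_candelabra posG (fun w : bool * bool => w.1.*2 + w.2)%N quadrupling.
Proof.
move=> i x y [j z] _ yx /= ji.
have xy : x != y by apply/eqP=> e; move: yx; rewrite e; lia.
rewrite eqxx /two (negbTE xy); case: ifP => s; first by exists (j, g x y z).
exists (mate j, x + y - shift i - z) => //=.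
by case: i j s ji => [[] []] [[] []].
Qed.

End Quadrupling.

Theorem step_order_quadruple n : 0 < n ->
  step_order n.*2.+2 -> step_order (4 * n.*2 + 2).
Proof.
case: n => // n _ sv; pose k := n.*2.
have kn : k.+2 = n.+1.*2 by rewrite /k.
have [g gO] : exists g : 'I_k.+2 -> _, one_factorization g.
  by apply: one_factorization_exists; rewrite card_ord kn odd_double.
rewrite addnC -kn.
apply: (@step_order_fill bool 'I_k.+2 (bool * bool)%type 2 k.+2 4 _ _ _
  nat_of_bool (@nat_of_ord _) (fun w => w.1.*2 + w.2) _ _ _ _ _ _ _ _ _ _
  (quadrupling n.+1 g)); rewrite ?card_prod ?card_bool ?card_ord //=.
- by case=> [] [].
- by case.
- exact: ord_inj.
- by move=> [[] []] [[] []].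
- by move=> [[] []].
- by rewrite negbK odd_double.
- exact: quadrupling_candelabra.
- exact: quadrupling_stepped.
Qed.

(* No block through a pair of the order of [G] meets two further groups. *)
Definition flat_pairs (S G W : eqType) (posG : G -> nat)
    (h : S + W * G -> S + W * G -> S + W * G -> S + W * G) : Prop :=
  forall i j x y z, i != j -> ~~ odd (posG x) -> posG y = (posG x).+1 ->
    exists z', h (inr (i, x)) (inr (i, y)) (inr (j, z)) = inr (j, z').

(* Blow up the points of a quadruple system other than [None]: blocks avoiding [None]
   become transversal designs, blocks through [None] candelabra systems with three groups. *)
Section Inflation.

Variables (S G : eqType) (n : nat).
Let W := 'I_n.
Let point := (S + W * G)%type.
Let point3 := (S + 'I_3 * G)%type.

Variable F : option W -> option W -> option W -> option W.
Hypothesis FS : skein F.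
Variable Q : G -> G -> G -> G.
Hypotheses (QC12 : forall x y z, Q x y z = Q y x z) (QC23 : forall x y z, Q x y z = Q x z y).
Hypothesis QK : forall x y z, Q x y (Q x y z) = z.
Variable h : point3 -> point3 -> point3 -> point3.
Hypothesis hC : candelabra h.

Implicit Types (x y z w : W) (a b c : point) (L : seq W).

(** Blocks through [None] induce a Steiner triple system on the other points, whose triples are the
    lines. The default is reached only for [x = y]. *)
Definition third x y : W := odflt x (F None (Some x) (Some y)).

Lemma thirdE x y : x != y -> F None (Some x) (Some y) = Some (third x y).
Proof.
move=> xy; rewrite /third; case E: (F _ _ _) => //=.
by move/eqP: E; rewrite (skein_eq1 FS) => /eqP[] /eqP; rewrite (negbTE xy).
Qed.

Lemma thirdC x y : x != y -> third x y = third y x.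
Proof. by move=> xy; rewrite {1}/third (skeinC23 FS) thirdE 1?eq_sym. Qed.

Lemma third_neq x y : x != y -> (third x y != x) /\ (third x y != y).
Proof.
move=> xy; have e := thirdE xy; split; apply/eqP => t; rewrite t in e; move/eqP: e.
  by rewrite (skein_eq2 FS).
by rewrite (skein_eq3 FS).
Qed.

Lemma thirdK x y : x != y -> third x (third x y) = y.
Proof. by move=> xy; rewrite {1}/third -thirdE // (skeinK FS). Qed.

(** Sorting makes the list depend only on the set of points, so all triples over one line pass
    through the same copy of [h]. *)
Definition line x y : seq W := sort (fun u v : W => u <= v) [:: x; y; third x y].

Lemma line_perm x y x' y' : perm_eq [:: x; y; third x y] [:: x'; y'; third x' y'] ->
  line x y = line x' y'.
Proof.
move=> p; apply/perm_sortP => //.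
- by move=> u v; apply: leq_total.
- by move=> u v w; apply: leq_trans.
- by move=> u v /anti_leq /ord_inj.
Qed.

Lemma mem_line x y u : u \in line x y = (u \in [:: x; y; third x y]).
Proof. by rewrite mem_sort. Qed.

Lemma line_uniq x y : x != y -> uniq (line x y).
Proof.
move=> xy; have [tx ty] := third_neq xy.
by rewrite sort_uniq /= !inE (negbTE xy) eq_sym (negbTE tx) eq_sym ty.
Qed.

Lemma size_line x y : size (line x y) = 3.
Proof. by rewrite size_sort. Qed.

Definition is_line L : Prop := exists x y, x != y /\ L = line x y.

Lemma is_lineE L u v : is_line L -> u \in L -> v \in L -> u != v -> L = line u v.
Proof.
case=> x [y [xy ->]]; have [tx ty] := third_neq xy.
have tK := thirdK xy; have tK' : third y (third x y) = x by rewrite (thirdC xy) thirdK // eq_sym.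
rewrite !mem_line !inE => /or3P[] /eqP-> /or3P[] /eqP->; rewrite ?eqxx // => uv; apply: line_perm;
  rewrite ?tK ?tK' ?(thirdC uv) ?tK ?tK' //;
  by apply/seq.permP => p /=; lia.
Qed.

Definition on_line L a : bool := if a is inr p then p.1 \in L else true.

Definition encode L a : point3 :=
  match a with inl s => inl s | inr p => inr (inord (index p.1 L), p.2) end.

Definition decode (x0 : W) L (a : point3) : point :=
  match a with inl s => inl s | inr p => inr (nth x0 L p.1, p.2) end.

Lemma encodeK x0 L : is_line L -> {in on_line L, cancel (encode L) (decode x0 L)}.
Proof.
case=> x [y [xy ->]] [s|[w g]] //; rewrite unfold_in /= => wL.
by rewrite inordK ?nth_index // -[3](size_line x y) index_mem.
Qed.

Lemma decodeK x0 L : is_line L -> cancel (decode x0 L) (encode L).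
Proof.
case=> x [y [xy ->]] [s|[i g]] //=.
by rewrite index_uniq ?line_uniq ?size_line ?inord_val.
Qed.

Lemma on_line_decode x0 L (a : point3) : is_line L -> on_line L (decode x0 L a).
Proof. by case=> x [y [xy ->]]; case: a => [s|[i g]] //=; rewrite mem_nth ?size_line. Qed.

Lemma apart_encode L a b : is_line L -> on_line L a -> on_line L b ->
  apart (encode L a) (encode L b) = apart a b.
Proof.
move=> lL; case: a b => [s|[x g]] [t|[y g']] //= xL yL; congr negb.
apply/eqP/eqP => [e|-> //].
have := congr1 (nth x L) (congr1 val e).
case: lL xL yL => u [v [uv ->]] xL yL.
by rewrite /= !inordK ?nth_index // -[3](size_line u v) index_mem.
Qed.

Lemma crossing_encode L a b c : is_line L -> on_line L a -> on_line L b -> on_line L c ->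
  crossing (encode L a) (encode L b) (encode L c) = crossing a b c.
Proof. by move=> lL aL bL cL; rewrite /crossing !apart_encode. Qed.

(** Three distinct groups on a line also give [None] here, because the block of [F] through them
    contains the deleted point. *)
Definition fourth a b c : option W :=
  match a, b, c with
  | inr p, inr q, inr r =>
    if [&& p.1 != q.1, p.1 != r.1 & q.1 != r.1]
    then F (Some p.1) (Some q.1) (Some r.1) else None
  | _, _, _ => None
  end.

Definition line_of a b c : option (W * seq W) :=
  let l (a b : point) := match a, b with
    | inr p, inr q => if p.1 != q.1 then Some (p.1, line p.1 q.1) else None
    | _, _ => None end in
  if l a b is Some k then Some k else if l a c is Some k then Some k else l b c.

Definition inflate a b c : point :=
  match a, b, c with
  | inr p, inr q, inr r =>
    if fourth a b c is Some w then inr (w, Q p.2 q.2 r.2) else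
    if line_of a b c is Some (x0, L)
    then decode x0 L (h (encode L a) (encode L b) (encode L c)) else a
  | _, _, _ =>
    if line_of a b c is Some (x0, L)
    then decode x0 L (h (encode L a) (encode L b) (encode L c)) else a
  end.

Lemma line_of_inflate a b c L : is_line L -> on_line L a -> on_line L b -> on_line L c ->
  crossing a b c ->
  forall x0, inflate a b c = decode x0 L (h (encode L a) (encode L b) (encode L c)).
Proof.
move=> lL aL bL cL cr x0.
have dec_x0 x1 d : decode x1 L d = decode x0 L d.
  case: lL => x [y [xy ->]]; case: d => [s|[i g]] //=.
  by congr (inr (_, _)); apply: set_nth_default; rewrite size_line.
have lE u v : u \in L -> v \in L -> u != v -> line u v = L.
  by move=> uL vL uv; rewrite -(is_lineE lL uL vL uv).
have -> : inflate a b c = if line_of a b c is Some (x0, L)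
    then decode x0 L (h (encode L a) (encode L b) (encode L c)) else a.
  rewrite /inflate; case: a b c aL bL cL {cr} => [s|[x g]] [t|[y k]] [u|[z m]] //= xL yL zL.
  case: ifP => // /and3P[xy xz yz].
  suff -> : F (Some x) (Some y) (Some z) = None by [].
  have : z \in line x y by rewrite lE.
  rewrite mem_line !inE eq_sym (negbTE xz) eq_sym (negbTE yz) /= => /eqP->.
  by have [_ _ ->] := skein_block FS (thirdE xy).
rewrite /line_of; case: a b c aL bL cL cr => [s|[x g]] [t|[y k]] [u|[z m]] //= aL bL cL;
  rewrite /crossing /= ?orbF // => cr.
- by rewrite cr lE.
- by rewrite cr lE.
- by rewrite cr lE.
- case: (altP (x =P y)) cr => [<-|xy _] /=; last by rewrite lE.
  by rewrite orbb => xz; rewrite xz lE.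
Qed.

Lemma inflateP a b c : crossing a b c ->
  (exists L, [/\ is_line L, on_line L a, on_line L b & on_line L c]) \/
  (exists x y z w, exists g k m : G, [/\ a = inr (x, g), b = inr (y, k), c = inr (z, m),
    [&& x != y, x != z & y != z] & F (Some x) (Some y) (Some z) = Some w]).
Proof.
have ex x y : x != y -> is_line (line x y) by exists x, y.
case: a b c => [s|[x g]] [t|[y k]] [u|[z m]]; rewrite /crossing /= ?orbF // => cr.
- by left; exists (line y z); split; (try exact: ex); rewrite //= mem_line !inE eqxx ?orbT.
- by left; exists (line x z); split; (try exact: ex); rewrite //= mem_line !inE eqxx ?orbT.
- by left; exists (line x y); split; (try exact: ex); rewrite //= mem_line !inE eqxx ?orbT.
case: (altP (x =P y)) cr => [-> /= |xy _].
  rewrite orbb => yz; left; exists (line y z).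
  by split; (try exact: ex); rewrite //= mem_line !inE eqxx ?orbT.
case: (altP (x =P z)) => [<-|xz].
  by left; exists (line x y); split; (try exact: ex); rewrite //= mem_line !inE eqxx ?orbT.
case: (altP (y =P z)) => [<-|yz].
  by left; exists (line x y); split; (try exact: ex); rewrite //= mem_line !inE eqxx ?orbT.
case E: (F (Some x) (Some y) (Some z)) => [w|].
  by right; exists x, y, z, w, g, k, m; rewrite xy xz yz.
left; exists (line x y); split; (try exact: ex); rewrite /= mem_line !inE ?eqxx ?orbT //.
have [xyz _ _] := skein_block FS E.
have e : F None (Some x) (Some y) = Some z by rewrite (skein_sym FS xyz).
by rewrite /third e /= eqxx !orbT.
Qed.

Lemma inflate_transversal x y z w g k m : [&& x != y, x != z & y != z] ->
  F (Some x) (Some y) (Some z) = Some w ->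
  inflate (inr (x, g)) (inr (y, k)) (inr (z, m)) = inr (w, Q g k m).
Proof. by move=> d e; rewrite /inflate /= d e. Qed.

Lemma inflate_candelabra : candelabra inflate.
Proof.
have [h1 h2 h3 h4] := hC.
(* A default for [nth]: [W] may be empty, but a crossing triple supplies an element. *)
have x0_of a b c : crossing a b c -> W.
  by case: a b c => [s|[x g]] [t|[y k]] [u|[z m]] // _; exact: x || exact: y.
split=> [a b c cr|a b c cr|a b ab|a b c cr].
- have [[L [lL aL bL cL]]|[x [y [z [w [g [k [m [-> -> ->]]]]]]]]] := inflateP cr.
    have x0 := x0_of _ _ _ cr; have cr' := cr; rewrite crossing12 in cr'.
    rewrite (line_of_inflate lL aL bL cL cr x0) (line_of_inflate lL bL aL cL cr' x0).
    by rewrite h1 // crossing_encode.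
  case/and3P=> xy xz yz e; rewrite (inflate_transversal _ _ _ _ e) ?xy ?xz //.
  rewrite (skeinC12 FS) in e.
  have d : [&& y != x, y != z & x != z] by rewrite eq_sym xy xz yz.
  by rewrite (inflate_transversal _ _ _ d e) QC12.
- have [[L [lL aL bL cL]]|[x [y [z [w [g [k [m [-> -> ->]]]]]]]]] := inflateP cr.
    have x0 := x0_of _ _ _ cr; have cr' := cr; rewrite crossing23 in cr'.
    rewrite (line_of_inflate lL aL bL cL cr x0) (line_of_inflate lL aL cL bL cr' x0).
    by rewrite h2 // crossing_encode.
  case/and3P=> xy xz yz e; rewrite (inflate_transversal _ _ _ _ e) ?xy ?xz //.
  rewrite (skeinC23 FS) in e.
  have d : [&& x != z, x != y & z != y] by rewrite [z == y]eq_sym xy xz yz.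
  by rewrite (inflate_transversal _ _ _ d e) QC23.
- have cr : crossing a a b by rewrite /crossing ab !orbT.
  have [[L [lL aL _ bL]]|[x [y [z [w [g [k [m [ax ay _ d _]]]]]]]]] := inflateP cr; last first.
    by case/and3P: d; move: ay; rewrite ax => -[-> _]; rewrite eqxx.
  have x0 := x0_of _ _ _ cr.
  by rewrite (line_of_inflate lL aL aL bL cr x0) h3 ?apart_encode // (encodeK x0 lL).
have [[L [lL aL bL cL]]|[x [y [z [w [g [k [m [-> -> ->]]]]]]]]] := inflateP cr.
  have x0 := x0_of _ _ _ cr.
  have [] := h4 (encode L a) (encode L b) (encode L c); first by rewrite crossing_encode.
  rewrite (line_of_inflate lL aL bL cL cr x0); set d := h _ _ _ => crd hd.
  have dL : on_line L (decode x0 L d) by apply: on_line_decode.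
  have crd' : crossing a b (decode x0 L d) by rewrite -(crossing_encode lL) // (decodeK x0 lL).
  split=> //; rewrite (line_of_inflate lL aL bL dL crd' x0) (decodeK x0 lL) hd.
  exact: (encodeK x0 lL).
case/and3P=> xy xz yz e; rewrite (inflate_transversal _ _ _ _ e) ?xy ?xz //.
have [xyw _ _] := skein_block FS e.
split; first by rewrite /crossing /= xy.
rewrite (inflate_transversal _ _ _ _ xyw) ?QK // xy /=.
apply/andP; split; apply/eqP => E; rewrite -E in e; move/eqP: e.
  by rewrite (skein_eq1 FS); case/eqP=> /eqP; apply/negP.
by rewrite (skein_eq2 FS); case/eqP=> /eqP; apply/negP.
Qed.

(** Any two groups lie on a line, and flatness of [h] over that line keeps the fourth point in the
    group of the third. *)
Lemma inflate_stepped (posG : G -> nat) :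
  flat_pairs posG h ->
  stepped_candelabra posG (@nat_of_ord n) inflate.
Proof.
move=> flat w x y [w' z] ox yx; rewrite [(w', z).1]/= => w'w.
have ww' : w != w' by apply/eqP => e; rewrite e ltnn in w'w.
pose L := line w w'.
have lL : is_line L by exists w, w'.
have [wL w'L] : w \in L /\ w' \in L by rewrite !mem_line !inE !eqxx orbT.
have cr : crossing (inr (w, x) : point) (inr (w, y)) (inr (w', z)).
  by rewrite /crossing /= ww' !orbT.
have ij : (inord (index w L) : 'I_3) != inord (index w' L).
  by have := @apart_encode L (inr (w, x)) (inr (w', z)) lL wL w'L; rewrite /= => ->.
have [z' hz'] := flat _ _ x y z ij ox yx.
exists (w', z') => //; rewrite (line_of_inflate lL _ _ _ cr w) // /encode hz' /=.
by rewrite inordK ?nth_index // -[3](size_line w w') index_mem.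
Qed.

End Inflation.

Theorem step_order_inflate (S G : finType) (nS nG n : nat) (posS : S -> nat) (posG : G -> nat)
    (Q : G -> G -> G -> G) (h : S + 'I_3 * G -> S + 'I_3 * G -> S + 'I_3 * G -> S + 'I_3 * G) :
  #|S| = nS -> #|G| = nG -> injective posS -> (forall s, posS s < nS) ->
  injective posG -> (forall g, posG g < nG) -> (nS == 2) || (nS == 4) -> ~~ odd nG ->
  (forall x y z, Q x y z = Q y x z) -> (forall x y z, Q x y z = Q x z y) ->
  (forall x y z, Q x y (Q x y z) = z) -> candelabra h -> flat_pairs posG h -> 0 < n ->
  step_order n.+1 -> step_order (nS + nG) -> step_order (nS + n * nG).
Proof.
move=> cS cG pS pSlt pG pGlt nS24 evG Q1 Q2 QK hC hf n0 sn sSG.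
have [F [FS _]] : exists F : option 'I_n -> _, skein F /\
    stepped (fun o => if o is Some x then (nat_of_ord x).+1 else 0) F.
  apply: step_order_on sn.
  - by rewrite card_option card_ord.
  - by move=> [x|] [y|] //= [] /ord_inj->.
  - by move=> [x|] //=; rewrite ltnS.
have evS : ~~ odd nS by case/orP: nS24 => /eqP->.
apply: (@step_order_fill S G 'I_n nS nG n cS cG (card_ord n) posS posG (@nat_of_ord n)
  pS pSlt pG pGlt (@ord_inj n) (@ltn_ord n) evS evG n0 nS24 (inflate F Q h)) => //.
- exact: (inflate_candelabra FS Q1 Q2 QK hC).
- exact: inflate_stepped.
Qed.

(* One-factorizations in which every factor uses only one difference up to sign,
   or only even differences and the antipode. *)
Section CirculantOneFactorization.

Local Open Scope ring_scope.

Variables (k n : nat).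
Hypothesis kn : (k.+2 = n.*2)%N.
Let G := 'I_k.+2.
Implicit Types x y z d : G.
Let anti : G := antipode k n.

Variable small : pred G.
Hypotheses (small_odd : forall d, small d -> odd d) (smallN : forall d, small (- d) = small d).
Hypothesis small_anti : small anti = false.

Let oddD := @odd_ordD k n kn.
Let oddN := @odd_ordN k n kn.

(** For odd [d], the factor joins each even [z] to [z + d]; accordingly [step] is the difference
    oriented from the even end to the odd end. *)
Let shifted d z : G := if odd z then z - d else z + d.
Let step x y : G := if odd x then x - y else y - x.

Let stepC x y : odd x != odd y -> step x y = step y x.
Proof. by rewrite /step; case: (odd x); case: (odd y). Qed.

Let shifted1 x y : shifted (step x y) x = y.
Proof. by rewrite /shifted /step; case: (odd x); ring. Qed.

Let odd_step x y : odd (step x y) = odd x (+) odd y.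
Proof. by rewrite /step; case ox: (odd x); rewrite oddD oddN ox //= addbF. Qed.

Let odd_shifted d z : odd (shifted d z) = odd d (+) odd z.
Proof. by rewrite /shifted; case oz: (odd z); rewrite oddD ?oddN oz addbC. Qed.

Let step_shifted d z : step z (shifted d z) = d.
Proof. by rewrite /step /shifted; case: (odd z); ring. Qed.

Let small_step x y : small (step x y) = small (y - x).
Proof. by rewrite /step; case: ifP => // _; rewrite -smallN opprB. Qed.

Let evenN_small d : ~~ odd d -> small d = false.
Proof. by move=> od; apply/negP => /small_odd; rewrite (negbTE od). Qed.

(** Each parity class has even size [n], so one factorization of ['I_n], used on both classes at
    once, takes care of the even differences. *)
Lemma circulant_one_factorization_even : ~~ odd n ->
  exists g : G -> G -> G -> G, one_factorization g /\
    forall x y z, small (g x y z - z) = small (y - x).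
Proof.
move=> ev; have [g gO] : exists g : 'I_n -> _, one_factorization g.
  by apply: one_factorization_exists; rewrite card_ord.
have halfn x : (x./2 < n)%N by have := ltn_ord x; rewrite [X in (_ < X)%N]kn; lia.
pose hf x : 'I_n := Ordinal (halfn x).
pose dbl (a : 'I_n) (b : bool) : G := inZp (a.*2 + b).
have valdbl a b : dbl a b = (a.*2 + b)%N :> nat.
  by rewrite /= modn_small // kn; have := ltn_ord a; case: b => /=; lia.
have oddbl a b : odd (dbl a b) = b by rewrite valdbl ssrnat.oddD odd_double oddb.
have hfdbl a b : hf (dbl a b) = a.
  apply/ord_inj; rewrite [LHS](_ : _ = (dbl a b)./2) // valdbl.
  by case: b => /=; lia.
have dblhf x : dbl (hf x) (odd x) = x.
  by apply/ord_inj; rewrite valdbl /= addnC odd_double_half.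
exists (fun x y z => if odd x == odd y then dbl (g (hf x) (hf y) (hf z)) (odd z)
                     else shifted (step x y) z).
split; first split=> [x y z|x y|x z|x y z t] /=.
- rewrite eq_sym; case: eqP => // /eqP xy; first by rewrite (ofacC gO).
  by rewrite stepC // eq_sym.
- case: eqP => [xy|_]; last exact: shifted1.
  by rewrite (ofac1 gO) xy dblhf.
- by rewrite eqxx (ofacxx gO) dblhf.
- case: (altP (odd x =P odd y)) => [xy|xy].
    by rewrite oddbl eqxx hfdbl (ofac_edge gO).
  rewrite odd_shifted odd_step step_shifted.
  by case: (odd x) (odd y) (odd z) xy => [] [] [].
move=> x y z /=; case: (altP (odd x =P odd y)) => [xy|xy].
  by rewrite !evenN_small // oddD oddN ?oddbl ?xy addbb.
by rewrite -small_step step_shifted small_step.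
Qed.

(** The parity classes now have odd size and no factorization of their own. Even differences are
    sorted by their even sum [c] instead: [z] is matched with [c - z], and the two halves of [c],
    which this would fix, are matched with each other by an antipodal edge. *)
Lemma circulant_one_factorization_odd : odd n ->
  exists g : G -> G -> G -> G, one_factorization g /\
    forall x y z, small (g x y z - z) = small (y - x).
Proof.
move=> on.
have oanti : odd anti by rewrite /anti (val_antipode kn).
have antiN : - anti = anti := antipodeN kn.
have antiD : anti + anti = 0 := antipodeD kn.
pose sumtype x y := ~~ odd (y - x)%R || (y - x == anti).
pose csum x y : G := if y - x == anti then x + x else x + y.
pose partner (c z : G) : G := if c - z == z then z + anti else c - z.
have even_csum x y : sumtype x y -> odd (csum x y) = false.
  rewrite /csum; case: eqP => [_ _|ne]; first by rewrite oddD addbb.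
  by rewrite /sumtype; case/orP=> [|/eqP//]; rewrite !oddD oddN addbC => /negbTE.
have antisym x y : (y - x == anti) = (x - y == anti).
  by apply/eqP/eqP => e; rewrite -opprB e antiN.
exists (fun x y z => if x == y then z else
   if sumtype x y then partner (csum x y) z else shifted (step x y) z).
have stC x y : sumtype x y = sumtype y x.
  by rewrite /sumtype antisym -opprB oddN.
have sumP (c : G) z : odd c = false ->
    [/\ z != partner c z, sumtype z (partner c z) & csum z (partner c z) = c].
  move=> oc; have oz : odd (c - z - z)%R = false by rewrite !oddD oc oddN addbb.
  have nz : (c - z - z == anti) = false by apply/eqP => e; rewrite e oanti in oz.
  rewrite /partner; case: (c - z =P z) => e.
    have zz : z + anti - z = anti by ring.
    rewrite /sumtype /csum zz eqxx orbT; split=> //.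
      by rewrite -{1}[z]addr0 (inj_eq (addrI z)); apply/eqP => e0; move: oanti; rewrite -e0.
    by rewrite -{1}e subrK.
  rewrite /sumtype /csum nz oz; split=> //; first by rewrite eq_sym; apply/eqP.
  by ring.
have shP d z : odd d -> d != anti ->
    [/\ z != shifted d z, sumtype z (shifted d z) = false & step z (shifted d z) = d].
  move=> od nd; have st := step_shifted d z; split=> //.
    apply/eqP => e; move: (odd_shifted d z); rewrite -e od; by case: (odd z).
  rewrite /sumtype.
  have: shifted d z - z = d \/ shifted d z - z = - d.
    by rewrite /shifted; case: ifP => _; [right|left]; ring.
  case=> ->; rewrite ?oddN od ?(negbTE nd) //=.
  by rewrite -[X in _ == X]antiN (inj_eq oppr_inj) (negbTE nd).
have stepP x y : sumtype x y = false -> odd (step x y) /\ step x y != anti.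
  rewrite /sumtype => /negbT; rewrite negb_or negbK => /andP[o n0].
  rewrite odd_step -oddN -oddD addrC [odd _]o; split=> //.
  by rewrite /step; case: ifP => // _; rewrite antisym.
split; first split=> [x y z|x y|x z|x y z t] /=.
- rewrite eq_sym; case: (altP (y =P x)) => // yx.
  rewrite stC; case: ifP => st.
    congr partner; rewrite /csum antisym; case: ifP => [/eqP e|_]; last exact: addrC.
    have -> : x = y + anti by rewrite -e; ring.
    by rewrite addrACA antiD addr0.
  rewrite stepC //; move: st; rewrite /sumtype => /negbT; rewrite negb_or negbK oddD oddN.
  by case/andP=> + _; case: (odd x); case: (odd y).
- case: (altP (x =P y)) => // xy; case: ifP => st; last exact: shifted1.
  rewrite /partner /csum; case: (y - x =P anti) => [e|ne].
    by rewrite addrK eqxx -e; ring.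
  rewrite (_ : x + y - x = y); last by ring.
  by rewrite eq_sym (negbTE xy).
- by rewrite eqxx.
- case: (altP (x =P y)) => xy; first by rewrite eqxx.
  case st: (sumtype x y).
    have [/negbTE-> -> ->] // := sumP (csum x y) z (even_csum _ _ st).
  have [os ns] := stepP _ _ st.
  by have [/negbTE-> -> ->] // := shP (step x y) z os ns.
move=> x y z /=; case: (altP (x =P y)) => [->|xy]; first by rewrite !subrr.
have sts x' y' : sumtype x' y' -> small (y' - x') = false.
  by case/orP=> [/evenN_small|/eqP->].
case st: (sumtype x y).
  have [_ st' _] := sumP (csum x y) z (even_csum _ _ st).
  by rewrite !sts.
have [os ns] := stepP _ _ st; have [_ _ e] := shP (step x y) z os ns.
by rewrite -small_step e small_step.
Qed.

End CirculantOneFactorization.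

Lemma ord3_cases (i : 'I_3) : [|| i == 0, i == 1 | i == 2%:R]%R.
Proof. by case: i => [[|[|[|]]] lt]. Qed.

(** * Three groups completed by a rule on sums *)

Section Tripling.

Local Open Scope ring_scope.

Variables (S : eqType) (k : nat).
Let G := 'I_k.+2.
Let point := (S + 'I_3 * G)%type.
Implicit Types (i j m : 'I_3) (x y z d : G) (s : S).

(* A transversal triple with sum [d] is completed by a stem point if [d] is one of the
   [stem_sum s]; otherwise [d] belongs to a class [i], and the point in group [i] is
   moved so that the sum becomes [centre i - d]. [base i] recovers [d] from the move. *)
Variables (stem_sum : S -> G) (class : G -> S + 'I_3) (centre : 'I_3 -> G).
Variables (small : pred G) (base : 'I_3 -> G -> G) (g : G -> G -> G -> G).
Hypothesis class_stem : forall s, class (stem_sum s) = inl s.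
Hypothesis stem_class : forall d s, class d = inl s -> d = stem_sum s.
Hypothesis class_move : forall d i, class d = inr i ->
  [/\ class (centre i - d) = inr i, small (centre i - d - d) & base i (centre i - d - d) = d].
Hypothesis baseP : forall i d, small d ->
  class (base i d) = inr i /\ centre i - base i d - base i d = d.
Hypotheses (small0 : small 0 = false) (gO : one_factorization g).
Hypothesis small_g : forall x y z, small (g x y z - z) = small (y - x).

(** Exchanging the two points of a block that share group [i] turns the sum [d] into [centre i - d]
    and negates the move. *)
Let base_opp i d : small d -> small (- d) /\ base i (- d) = base i d + d.
Proof.
move=> sd; have [cb e] := baseP i sd; have [cm _ _] := class_move cb.
have [_ s1 e1] := class_move cm.
have E : centre i - (centre i - base i d) - (centre i - base i d) = - d.
  by rewrite -[in RHS]e; ring.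
rewrite E in s1 e1; split=> //; rewrite e1 -[in X in _ = _ + X]e; ring.
Qed.

Let smallN d : small (- d) = small d.
Proof.
apply/idP/idP => [|/(base_opp 0)[] //].
by move/(base_opp 0) => []; rewrite opprK.
Qed.

Let other i j : 'I_3 := - i - j.

(** A small difference is a move in group [i]: the sum through [x] has to be [base i (y - x)], which
    fixes the point in the third group. For other differences the block stays in two groups, and
    [small_g] keeps small differences out of the factor used. *)
Let two i x y j z : point :=
  if small (y - x) then inr (other i j, base i (y - x) - x - z) else inr (j, g x y z).

Let stem s i x j y : point := inr (other i j, stem_sum s - x - y).

Definition tripling (a b c : S + 'I_3 * 'I_k.+2) : S + 'I_3 * 'I_k.+2 :=
  match a, b, c with
  | inr (i, x), inr (j, y), inr (m, z) =>
    if i == j then two i x y m z else if i == m then two i x z j y else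
    if j == m then two j y z i x else
    match class (x + y + z) with
    | inl s => inl s
    | inr r => inr (r, (if r == i then x else if r == j then y else z)
                        + (centre r - (x + y + z) - (x + y + z)))
    end
  | inl s, inr (i, x), inr (j, y)
  | inr (i, x), inl s, inr (j, y)
  | inr (i, x), inr (j, y), inl s => stem s i x j y
  | _, _, _ => a
  end.

Let twoC i x y j z : two i x y j z = two i y x j z.
Proof.
rewrite /two -smallN opprB; case: ifP => sm; last by rewrite (ofacC gO).
have [_ e] := base_opp i sm; rewrite opprB in e.
by rewrite e; congr (inr (_, _)); ring.
Qed.

Let stemC s i x j y : stem s i x j y = stem s j y i x.
Proof. by rewrite /stem /other; congr (inr (_, _)); ring. Qed.

Let distinct3 i j m r : i != j -> i != m -> j != m -> [|| r == i, r == j | r == m].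
Proof.
by have := ord3_cases i; have := ord3_cases j; have := ord3_cases m; have := ord3_cases r;
   do 4![case/or3P=> /eqP->].
Qed.

Let otherP i j m : i != j -> i != m -> j != m -> other i j = m.
Proof.
by have := ord3_cases i; have := ord3_cases j; have := ord3_cases m;
   do 3![case/or3P=> /eqP->] => // _ _ _; apply/val_inj.
Qed.

Let other_neq i j : i != j -> [/\ i != other i j, j != other i j & other i (other i j) = j].
Proof.
move=> ij; split; last by rewrite /other; ring.
all: by move: ij; have := ord3_cases i; have := ord3_cases j; do 2![case/or3P=> /eqP->].
Qed.

Let trip12 a b c : crossing a b c -> tripling a b c = tripling b a c.
Proof.
case: a b c => [s|[i x]] [s'|[j y]] [s''|[m z]] //; rewrite /crossing /= ?orbF //.
rewrite (eq_sym j i); case: (altP (i =P j)) => [<- _|ij _]; first exact: twoC.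
case: (altP (i =P m)) => [<-|im]; first by rewrite eq_sym (negbTE ij).
case: (altP (j =P m)) => // jm; rewrite [y + x]addrC.
case: (class _) => // r; case: (altP (r =P i)) => [->|//]; by rewrite (negbTE ij).
Qed.

Let trip23 a b c : crossing a b c -> tripling a b c = tripling a c b.
Proof.
case: a b c => [s|[i x]] [s'|[j y]] [s''|[m z]] //; rewrite /crossing /= ?orbF //.
case: (altP (i =P j)) => [<-|ij] /=.
  case: (altP (i =P m)) => [<-|im _] //=.
case: (altP (i =P m)) => [//|im _]; rewrite (eq_sym m j).
case: (altP (j =P m)) => [<-|jm]; first exact: twoC.
rewrite [x + z + y]addrAC; case: (class _) => // r.
case: (altP (r =P i)) => // ri; case: (altP (r =P j)) => [->|rj].
  by rewrite (negbTE jm).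
by have := distinct3 r ij im jm; rewrite (negbTE ri) (negbTE rj) /= => ->.
Qed.

Let stemK s i x j y : i != j ->
  exists m z, [/\ stem s i x j y = inr (m, z), i != m & stem s i x m z = inr (j, y)].
Proof.
move=> ij; have [n1 n2 e] := other_neq ij.
exists (other i j), (stem_sum s - x - y); split=> //.
by rewrite /stem e; congr (inr (_, _)); ring.
Qed.

Let twoK i x y j z : i != j ->
  exists m t, [/\ two i x y j z = inr (m, t), i != m & two i x y m t = inr (j, z)].
Proof.
move=> ij; rewrite {1}/two; case: ifP => sm.
  have [n1 n2 e] := other_neq ij.
  exists (other i j), (base i (y - x) - x - z); split=> //.
  by rewrite /two sm e; congr (inr (_, _)); ring.
by exists j, (g x y z); rewrite /two sm (ofacK gO).
Qed.

Let trip_apart a b c : apart a b -> tripling a b (tripling a b c) = c.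
Proof.
case: a b => [l|[i x]] [l'|[j y]] // ij; rewrite /apart /= in ij.
have [n1 n2 e] := other_neq ij.
case: c => [s|[m z]].
  rewrite /= (negbTE ij) (negbTE n1) (negbTE n2).
  by rewrite (_ : x + y + _ = stem_sum s) ?class_stem //; ring.
have cr c' : crossing (inr (i, x)) (inr (j, y)) c' by rewrite /crossing /= ij.
have KK i' x' j' y' z' : i' != j' ->
    tripling (inr (i', x')) (inr (j', y')) (two i' x' z' j' y') = inr (i', z').
  move=> ij'; have [n1' n2' e'] := other_neq ij'; rewrite /two; case: ifP => sm.
    rewrite /= (negbTE ij') (negbTE n1') (negbTE n2').
    rewrite (_ : x' + y' + _ = base i' (z' - x')); last by ring.
    have [-> E] := baseP i' sm; rewrite eqxx E.
    by congr (inr (_, _)); ring.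
  rewrite /= (negbTE ij') eqxx /two small_g sm.
  by rewrite (ofac_edge gO) (ofac1 gO).
rewrite [X in tripling _ _ X]/tripling (negbTE ij).
case: (altP (i =P m)) => [<-|im]; first exact: KK.
case: (altP (j =P m)) => [<-|jm]; first by rewrite trip12 // KK // eq_sym.
case E: (class (x + y + z)) => [s|r].
  rewrite /= /stem (otherP ij im jm); congr (inr (_, _)).
  by rewrite -(stem_class E); ring.
(* The block has two points in group [r]. Going back applies the rule [two] if [r] is [i] or [j],
   and the rule for transversal triples if [r = m]. *)
have [cm sm bm] := class_move E.
case: (altP (r =P i)) E cm sm bm => [-> E cm sm bm|ri E cm sm bm].
  rewrite /= (negbTE ij) eqxx /two (_ : x + _ - x = centre i - (x + y + z) - (x + y + z)).
    by rewrite sm bm (otherP ij im jm); congr (inr (_, _)); ring.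
  by ring.
case: (altP (r =P j)) E cm sm bm => [-> E cm sm bm|rj E cm sm bm].
  rewrite /= (negbTE ij) eqxx /two.
  rewrite (_ : y + _ - y = centre j - (x + y + z) - (x + y + z)); last by ring.
  rewrite sm bm (@otherP j i m) // 1?eq_sym //; congr (inr (_, _)); ring.
have rm : r = m.
  by have := distinct3 r ij im jm; rewrite (negbTE ri) (negbTE rj) => /eqP.
rewrite rm in E cm sm bm *.
rewrite /= (negbTE ij) (negbTE im) (negbTE jm).
rewrite (_ : x + y + _ = centre m - (x + y + z)); last by ring.
rewrite cm eq_sym (negbTE im) eq_sym (negbTE jm); congr (inr (_, _)); ring.
Qed.

Lemma tripling_candelabra : candelabra tripling.
Proof.
split; [exact: trip12 | exact: trip23 | |].
  case=> [l|[i x]] [l'|[j y]] //= ij.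
  by rewrite eqxx /two subrr small0 (ofacxx gO).
move=> a b c cr; case ab: (apart a b).
  by rewrite trip_apart // /crossing ab.
case: a b c cr ab => [l|[i x]] [l'|[j y]] [l''|[m z]]; rewrite /crossing /= ?orbF // => cr.
- by move=> _; have [m' [z' [[<- <-] jm e]]] := stemK l y z cr; rewrite /= jm.
- by move=> _; have [m' [z' [[<- <-] im e]]] := stemK l' x z cr; rewrite /= im.
- by rewrite cr.
- move/negbFE/eqP => ij; rewrite -ij eqxx /= in cr *.
  rewrite orbb in cr.
  by have [m' [z' [-> im e]]] := twoK x y z cr; rewrite /= im.
Qed.

Lemma tripling_flat (posG : G -> nat) :
  (forall x y, ~~ odd (posG x) -> posG y = (posG x).+1 -> small (y - x) = false) ->
  flat_pairs posG tripling.
Proof.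
move=> sm i j x y z ij ox yx; exists (g x y z).
by rewrite /= eqxx /two (sm _ _ ox yx).
Qed.

End Tripling.

Lemma val_ordB k (x y : 'I_k.+2) :
  (x - y)%R = (if y <= x then x - y else x + k.+2 - y) :> nat.
Proof.
have [ltx lty] := (ltn_ord x, ltn_ord y); rewrite [LHS]/= modnDmr.
case: leqP => yx; last by rewrite addnBA ?modn_small //; lia.
have -> : x + (k.+2 - y) = (x - y) + k.+2 by lia.
by rewrite modnDr modn_small //; lia.
Qed.

Lemma modn_upper k n (kn : k.+2 = n.*2) (z : 'I_k.+2) :
  z %% n = (if n <= z then z - n else z).
Proof.
have lz := ltn_ord z; case: leqP => nz; last by rewrite modn_small.
by rewrite -{1}(subnK nz) modnDr modn_small //; lia.
Qed.

Lemma step_order2 : step_order 2.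
Proof.
exists (fun a b c : 'I_2 => a + b + c)%R; split.
  split=> [a b c|a b c|a b|a b c]; try ring.
    by case: a b => [[|[|m]] lm] [[|[|m']] lm'] //; apply/val_inj.
  by case: a b c => [[|[|m]] lm] [[|[|m']] lm'] [[|[|p]] lp] //; apply/val_inj.
by move=> [[|[|m]] lm] [[|[|m']] lm'].
Qed.

(** * Classes of sums that are intervals *)

Section IntervalTripling.

Variables (r t k n : nat).
Hypotheses (r0 : 0 < r) (kn : k.+2 = n.*2) (n_rt : n.*2 = 6 * r + t.+1).
Hypothesis t_odd : odd t.
Let G := 'I_k.+2.
Implicit Types (i : 'I_3) (d : G) (s : 'I_t.+1).

Let stem_sum s : G := inZp (6 * r + s).
Let class d : 'I_t.+1 + 'I_3 :=
  if d < 2 * r then inr 0%R else if d < 4 * r then inr 1%R else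
  if d < 6 * r then inr 2%:R%R else inl (inord (d - 6 * r)).
(** The sum of the two ends of the interval of class [i], so [mid i - d] is the reflection of that
    interval. Whatever [i] is, the moves [mid i - 2d] run once through the odd numbers of absolute
    value below [2r]; these are the [small] differences. *)
Let mid i := 4 * r * i + 2 * r - 1.
Let centre i : G := inZp (mid i).
Let small d := odd d && ((d < 2 * r) || (k.+2 - 2 * r < d)).
Let base i d : G := inZp (if d < 2 * r then (mid i - d)./2 else (mid i + (k.+2 - d))./2).

Let val_small m : m < k.+2 -> (inZp m : G) = m :> nat.
Proof. by move=> lt; rewrite /= modn_small. Qed.

Let classP d i : class d = inr i <-> (2 * r * i <= d < 2 * r * i + 2 * r).
Proof.
have ltd := ltn_ord d; rewrite /class.
have v0 : (0%R : 'I_3) = 0 :> nat by [].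
have v1 : (1%R : 'I_3) = 1 :> nat by [].
have v2 : (2%:R%R : 'I_3) = 2 :> nat by [].
case: (ltnP d (2 * r)) => c0; [|case: (ltnP d (4 * r)) => c1; [|case: (ltnP d (6 * r)) => c2]];
  have := ord3_cases i; case/or3P=> /eqP->; rewrite ?v0 ?v1 ?v2; split;
  first [by move=> _; lia | by move=> ?; exfalso; lia | by []
    | by move/(congr1 (fun c : _ + 'I_3 => if c is inr j then nat_of_ord j else 3))].
Qed.

Let i2 i : i <= 2. Proof. by rewrite -ltnS. Qed.

Let subE m d : d <= m -> (inZp m - d)%R = inZp (m - d) :> G.
Proof. by move=> dm; rewrite -!Zp_nat natrB // natr_Zp. Qed.

Let move_val d i : class d = inr i -> (centre i - d)%R = mid i - d :> nat.
Proof.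
move/classP => dI; have ltd := ltn_ord d; have := i2 i; rewrite /centre /mid.
by case: (nat_of_ord i) dI => [|[|[|]]] // dI _; rewrite subE ?val_small //; lia.
Qed.

Let class_stem s : class (stem_sum s) = inl s.
Proof.
have v : stem_sum s = 6 * r + s :> nat by rewrite val_small // kn; have := ltn_ord s; lia.
rewrite /class v; do 3?[case: ifP => [|_]; first by move=> ?; exfalso; lia].
by congr inl; apply/ord_inj; rewrite addKn inordK.
Qed.

Let stem_class d s : class d = inl s -> d = stem_sum s.
Proof.
rewrite /class; do 3?[case: ifP => // ?]; case=> <-; apply/ord_inj.
have ltd := ltn_ord d; rewrite /stem_sum inordK; last by lia.
by rewrite val_small; lia.
Qed.

Let class_move d i : class d = inr i ->
  [/\ class (centre i - d)%R = inr i, small (centre i - d - d)%R &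
      base i (centre i - d - d)%R = d].
Proof.
move=> dI; have v := move_val dI; move/classP: dI => dI; have ltd := ltn_ord d.
have v2 := val_ordB (centre i - d)%R d; rewrite v in v2.
split.
- by apply/classP; rewrite v /mid; have := i2 i; case: (nat_of_ord i) dI => [|[|[|]]] //; lia.
- rewrite /small v2; move: v2 => _; rewrite /mid; have := i2 i.
  by case: (nat_of_ord i) dI => [|[|[|]]] // dI _; case: ifP => ?; lia.
- move: (centre i - d - d)%R v2 => e; rewrite /mid => v2; apply/ord_inj.
  rewrite /base /mid; have := i2 i.
  case: (nat_of_ord i) dI v2 => [|[|[|]]] // dI; case: ifP => c v2 _;
    case: ifP => c'; rewrite val_small; lia.
Qed.

Let baseP i d : small d ->
  class (base i d) = inr i /\ (centre i - base i d - base i d)%R = d.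
Proof.
case/andP=> od sd; have ltd := ltn_ord d.
have vb : base i d = (if d < 2 * r then (mid i - d)./2 else (mid i + (k.+2 - d))./2) :> nat.
  rewrite /base val_small // /mid; have := i2 i.
  by case: (nat_of_ord i) => [|[|[|]]] // _; case: ifP => ?; lia.
have cb : class (base i d) = inr i.
  apply/classP; rewrite vb /mid; have := i2 i.
  by case: (nat_of_ord i) => [|[|[|]]] // _; case: ifP => ?; lia.
split=> //; apply/ord_inj; rewrite val_ordB (move_val cb) vb /mid; have := i2 i.
by case: (nat_of_ord i) => [|[|[|]]] // _; case: (ltnP d (2 * r)) => ?; case: ifP => ?; lia.
Qed.

Let small_odd d : small d -> odd d. Proof. by case/andP. Qed.

Let smallN d : small (- d)%R = small d.
Proof.
have := val_ordB (0%R : G) d; rewrite sub0r /small => ->; have ltd := ltn_ord d.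
by rewrite [nat_of_ord 0%R]/=; case: ifP => ?; lia.
Qed.

Let small_anti : small (antipode k n) = false.
Proof. by rewrite /small (val_antipode kn) kn; lia. Qed.

(** The pairs of the order are antipodes, whose difference [n] is too far from 0 to be small. *)
Lemma interval_tripling : exists h : 'I_t.+1 + 'I_3 * G -> _,
  candelabra h /\ flat_pairs (fun x : G => (x %% n).*2 + (n <= x)) h.
Proof.
have [g [gO gs]] : exists g : G -> G -> G -> G, one_factorization g /\
    forall x y z, small (g x y z - z)%R = small (y - x)%R.
  case on: (odd n).
    exact: (circulant_one_factorization_odd kn small_odd smallN small_anti on).
  exact: (circulant_one_factorization_even kn small_odd smallN small_anti (negbT on)).
exists (tripling stem_sum class centre small base g); split.
  exact: tripling_candelabra.
apply: tripling_flat => x y ox yx.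
have [lx ly] := (ltn_ord x, ltn_ord y).
have dm (z : G) := modn_upper kn z.
suff -> : (y - x)%R = antipode k n by [].
apply/ord_inj; rewrite val_ordB (val_antipode kn); move: ox yx; rewrite !dm.
by case: (leqP n x) => ?; case: (leqP n y) => ?; case: ifP => ?; lia.
Qed.

End IntervalTripling.

Theorem step_order_triple r s : (s == 2) || (s == 4) -> 0 < r ->
  step_order (6 * r + s + s) -> step_order (3 * (6 * r + s) + s).
Proof.
move=> s24 r0 sv.
have [t [st ot]] : exists t, s = t.+1 /\ odd t by exists s.-1; case/orP: s24 => /eqP->.
have [k [n [kn nr]]] : exists k n, k.+2 = n.*2 /\ n.*2 = 6 * r + t.+1.
  by exists (6 * r + t.+1 - 2), ((6 * r + t.+1)./2); lia.
have [h [hC hf]] := interval_tripling r0 kn nr ot.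
have s4 : step_order 4 := step_order_double (isT : ~~ odd 2) step_order2.
have dm (z : 'I_k.+2) := modn_upper kn z.
rewrite addnC; have -> : 6 * r + s = k.+2 by lia.
(* In the system of order 4 the three points other than the deleted one form a single line, so its
   inflation is one copy of the tripling candelabra. *)
apply: (@step_order_inflate 'I_t.+1 'I_k.+2 s k.+2 3 (@nat_of_ord _)
  (fun x => (x %% n).*2 + (n <= x)) (fun x y z => - (x + y + z))%R h) => //.
- by rewrite card_ord.
- by rewrite card_ord.
- exact: ord_inj.
- by move=> x; rewrite st.
- move=> x y; have [lx ly] := (ltn_ord x, ltn_ord y); rewrite !dm => e; apply/ord_inj.
  by move: e; case: (leqP n x) => ?; case: (leqP n y) => ?; lia.
- by move=> x; have lx := ltn_ord x; rewrite dm; case: (leqP n x) => ?; lia.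
- by rewrite kn odd_double.
- by move=> x y z; congr (- _)%R; ring.
- by move=> x y z; congr (- _)%R; ring.
- by move=> x y z; ring.
- by rewrite (_ : s + k.+2 = 6 * r + s + s) //; lia.
Qed.

(* For evaluation, a point of group [i] is coded by [(i, x)] and a stem point by [(3, s)]. *)
Section CodedCandelabra.

Variables (s g : nat).
Let point := ('I_s.+1 + 'I_3 * 'I_g.+1)%type.

Definition code (a : point) : nat * nat :=
  match a with inl l => (3, nat_of_ord l) | inr p => (nat_of_ord p.1, nat_of_ord p.2) end.

Definition uncode (p : nat * nat) : point :=
  if p.1 == 3 then inl (inord p.2) else inr (inord p.1, inord p.2).

Definition codes : seq (nat * nat) :=
  [seq (3, l) | l <- iota 0 s.+1] ++ [seq (i, x) | i <- iota 0 3, x <- iota 0 g.+1].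

Definition apartn (p q : nat * nat) : bool := [&& p.1 != 3, q.1 != 3 & p.1 != q.1].

Definition crossingn (p q r : nat * nat) : bool := [|| apartn p q, apartn p r | apartn q r].

Variable h : nat * nat -> nat * nat -> nat * nat -> nat * nat.

Definition check_triple (p q r : nat * nat) : bool :=
  let t := h p q r in
  [&& t == h q p r, t == h p r q, t \in codes, crossingn p q t, h p q t == r &
      (p == q) ==> (t == r)].

Definition check_candelabra : bool :=
  all (fun p => all (fun q => all (fun r =>
    if crossingn p q r then check_triple p q r else true) codes) codes) codes.

Definition uncoded (a b c : point) : point := uncode (h (code a) (code b) (code c)).

Lemma codeK : cancel code uncode.
Proof.
case=> [l|[i x]]; rewrite /uncode /=; first by rewrite inord_val.
by have := ltn_ord i; case: eqP => [->//|_ _]; rewrite !inord_val.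
Qed.

Lemma mem_code a : code a \in codes.
Proof.
rewrite mem_cat; case: a => [l|[i x]]; apply/orP; [left|right].
  by apply/mapP; exists (nat_of_ord l); rewrite // mem_iota ltn_ord.
by apply/allpairsP; exists (nat_of_ord i, nat_of_ord x); rewrite !mem_iota !ltn_ord.
Qed.

Lemma uncodeK p : p \in codes -> code (uncode p) = p.
Proof.
rewrite mem_cat => /orP[/mapP[l ls ->]|/allpairsP[[i x] [i3 xg ->]]].
  by rewrite mem_iota in ls; rewrite /uncode /= inordK.
rewrite !mem_iota /= in i3 xg; rewrite /uncode /=; case: eqP i3 => [-> //|_ i3].
by rewrite /= !inordK.
Qed.

Lemma apart_code a b : apart a b = apartn (code a) (code b).
Proof.
rewrite /apartn; case: a b => [l|[i x]] [m|[j y]] //=; first by rewrite andbF.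
have [i3 j3] := (ltn_ord i, ltn_ord j).
by rewrite (ltn_eqF i3) (ltn_eqF j3).
Qed.

Lemma crossing_code a b c : crossing a b c = crossingn (code a) (code b) (code c).
Proof. by rewrite /crossing !apart_code. Qed.

Lemma check_candelabraP : check_candelabra -> candelabra uncoded.
Proof.
move=> ck.
have chk a b c : crossing a b c -> check_triple (code a) (code b) (code c).
  rewrite crossing_code => cr.
  have /allP/(_ _ (mem_code b))/allP/(_ _ (mem_code c)) := allP ck _ (mem_code a).
  by rewrite cr.
rewrite /uncoded; split=> [a b c /chk|a b c /chk|a b ab|a b c cr].
- by case/and5P=> /eqP->.
- by case/and5P=> _ /eqP->.
- have /chk/and5P[_ _ _ _ /andP[_]] : crossing a a b by rewrite /crossing ab !orbT.
  by rewrite eqxx => /eqP->; rewrite codeK.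
- have /and5P[_ _ m cr' /andP[/eqP e _]] := chk _ _ _ cr.
  by rewrite crossing_code (uncodeK m) e codeK.
Qed.

End CodedCandelabra.

(** * Explicit candelabra systems, verified by computation *)

Section Dispatch.

Variables (two stem : nat -> nat -> nat -> nat -> nat -> nat * nat)
  (three : nat -> nat -> nat -> nat * nat).

Definition dispatch (p q r : nat * nat) : nat * nat :=
  if p.1 == 3 then stem p.2 q.1 q.2 r.1 r.2 else
  if q.1 == 3 then stem q.2 p.1 p.2 r.1 r.2 else
  if r.1 == 3 then stem r.2 p.1 p.2 q.1 q.2 else
  if p.1 == q.1 then two p.1 p.2 q.2 r.1 r.2 else
  if p.1 == r.1 then two p.1 p.2 r.2 q.1 q.2 else
  if q.1 == r.1 then two q.1 q.2 r.2 p.1 p.2 else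
  let v i := if p.1 == i then p.2 else if q.1 == i then q.2 else r.2 in
  three (v 0) (v 1) (v 2).

End Dispatch.

(* Meaningful only when exactly two of the arguments agree mod 3. *)
Definition odd_one_out (x y z : nat) : nat :=
  if y == z %[mod 3] then 0 else if x == z %[mod 3] then 1 else 2.

Definition shift_coordinate (m i e x y z : nat) : nat * nat :=
  (i, ((if i == 0 then x else if i == 1 then y else z) + e) %% m).

(* The one-factorization of K_6 on Z_5 plus the point 5. *)
Definition K6_partner (x y z : nat) : nat :=
  if x == y then z else
  let c := (if x == 5 then y + y else if y == 5 then x + x else x + y) %% 5 in
  if z == 5 then (c * 3) %% 5 else
  let w := (c + 5 - z) %% 5 in if w == z then 5 else w.

(** Differences 1 and 11 come from the moves by 1. For 3 and 9, a transversal move needs [x] alone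
    in its class mod 3; then the third point agrees with [z], so the sum is [x - z] mod 3, below 3
    if [e = 3] and increased by 3 if [e = 9]. If [x] and [z] agree, a step by 3 inside the class is
    used. *)
Definition c12_two (i x y j z : nat) : nat * nat :=
  let e := (y + 12 - x) %% 12 in
  let o := 3 - i - j in
  if ~~ odd e then (j, (K6_partner x./2 y./2 z./2).*2 + odd z) else
  if (e \in [:: 5; 7]) || (e \in [:: 3; 9]) && (x == z %[mod 3]) then
    let e' := if odd x then 12 - e else e in
    (j, (if odd z then z + 12 - e' else z + e') %% 12)
  else if e \in [:: 1; 11] then
    (o, ((if e == 1 then 7 else 8) + i.*2 + 24 - x - z) %% 12)
  else (o, ((x + 12 - z) %% 3 + (if e == 3 then 0 else 3) + 24 - x - z) %% 12).

(** A sum prime to 3 forces exactly two coordinates to agree mod 3, so [odd_one_out] makes sense for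
    the sums 1, 2, 4, 5. Moving by 3 keeps all residues, hence the coordinate selected. *)
Definition c12_three (x y z : nat) : nat * nat :=
  let d := (x + y + z) %% 12 in
  if d == 3 then (3, 0) else if d == 6 then (3, 1) else
  if d == 0 then shift_coordinate 12 2 11 x y z else
  if 6 < d then shift_coordinate 12 ((d - 7)./2) (if odd d then 1 else 11) x y z
  else shift_coordinate 12 (odd_one_out x y z) (if d < 3 then 3 else 9) x y z.

Definition c12_stem (l i x j y : nat) : nat * nat :=
  (3 - i - j, (3 + 3 * l + 24 - x - y) %% 12).

(* A candelabra system with groups Z_12 and a stem of two points. The sums {7,8}, {9,10},
   {11,0} move one fixed coordinate by 1; {1,4} and {2,5} move the coordinate that is
   alone in its class mod 3 by 3; the sums 3 and 6 belong to the stem. *)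
Definition c12 := dispatch c12_two c12_stem c12_three.

Lemma c12_check : check_candelabra 1 11 c12.
Proof. by vm_compute. Qed.

Definition c10_two (i x y j z : nat) : nat * nat :=
  if x == y then (j, z) else if z == x then (j, y) else if z == y then (j, x)
  else (3 - i - j, z).

Definition c10_stem (_ i x j y : nat) : nat * nat := (3 - i - j, (6 - x - y) %% 3).

Definition c10_three (x y z : nat) : nat * nat :=
  if (x + y + z) %% 3 == 0 then (3, 0) else
  let i := odd_one_out x y z in
  (i, if i == 0 then (6 - x - y) %% 3 else if i == 1 then (6 - y - z) %% 3 else (6 - x - z) %% 3).

(* SQS(10) as a candelabra system with three groups Z_3 and a single stem point. *)
Definition c10 := dispatch c10_two c10_stem c10_three.

Lemma c10_check : check_candelabra 0 2 c10.
Proof. by vm_compute. Qed.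

(** Pairs are [{x, x + 6}]: their even difference never occurs as a move. *)
Definition pos12 (x : nat) : nat := (x %% 6).*2 + (6 <= x).

Lemma mem_iota_ord n (u : 'I_n) : nat_of_ord u \in iota 0 n.
Proof. by rewrite mem_iota ltn_ord. Qed.

Lemma c12_flat : flat_pairs (fun x : 'I_12 => pos12 x) (@uncoded 1 11 c12).
Proof.
have ck : all (fun i => all (fun j => all (fun x => all (fun y => all (fun z =>
    [&& i != j, ~~ odd (pos12 x) & pos12 y == (pos12 x).+1] ==> ((c12 (i, x) (i, y) (j, z)).1 == j))
    (iota 0 12)) (iota 0 12)) (iota 0 12)) (iota 0 3)) (iota 0 3).
  by vm_compute.
move=> i j x y z ij ox yx.
move: ck => /allP/(_ _ (mem_iota_ord i))/allP/(_ _ (mem_iota_ord j))/allP/(_ _ (mem_iota_ord x))/allP/(_ _ (mem_iota_ord y)).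
move=> /allP/(_ _ (mem_iota_ord z)); rewrite ox yx eqxx (inj_eq (@ord_inj 3)) ij /= => /eqP e.
by eexists; rewrite /uncoded /= /uncode e (ltn_eqF (ltn_ord j)) inord_val.
Qed.

(* Found by computer search; any two of the pairs [{2t, 2t+1}] form a block. *)
Definition blocks14 : seq (seq nat) :=
  [:: [:: 0; 1; 2; 3]; [:: 0; 1; 4; 5]; [:: 0; 1; 6; 7]; [:: 0; 1; 8; 9]; [:: 0; 1; 10; 11];
    [:: 0; 1; 12; 13]; [:: 0; 2; 4; 11]; [:: 0; 2; 5; 12]; [:: 0; 2; 6; 9]; [:: 0; 2; 7; 10];
    [:: 0; 2; 8; 13]; [:: 0; 3; 4; 12]; [:: 0; 3; 5; 9]; [:: 0; 3; 6; 10]; [:: 0; 3; 7; 13];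
    [:: 0; 3; 8; 11]; [:: 0; 4; 6; 13]; [:: 0; 4; 7; 8]; [:: 0; 4; 9; 10]; [:: 0; 5; 6; 8];
    [:: 0; 5; 7; 11]; [:: 0; 5; 10; 13]; [:: 0; 6; 11; 12]; [:: 0; 7; 9; 12];
    [:: 0; 8; 10; 12]; [:: 0; 9; 11; 13]; [:: 1; 2; 4; 6]; [:: 1; 2; 5; 11]; [:: 1; 2; 7; 12];
    [:: 1; 2; 8; 10]; [:: 1; 2; 9; 13]; [:: 1; 3; 4; 8]; [:: 1; 3; 5; 7]; [:: 1; 3; 6; 9];
    [:: 1; 3; 10; 13]; [:: 1; 3; 11; 12]; [:: 1; 4; 7; 13]; [:: 1; 4; 9; 11];
    [:: 1; 4; 10; 12]; [:: 1; 5; 6; 10]; [:: 1; 5; 8; 13]; [:: 1; 5; 9; 12]; [:: 1; 6; 8; 12];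
    [:: 1; 6; 11; 13]; [:: 1; 7; 8; 11]; [:: 1; 7; 9; 10]; [:: 2; 3; 4; 5]; [:: 2; 3; 6; 7];
    [:: 2; 3; 8; 9]; [:: 2; 3; 10; 11]; [:: 2; 3; 12; 13]; [:: 2; 4; 7; 9]; [:: 2; 4; 8; 12];
    [:: 2; 4; 10; 13]; [:: 2; 5; 6; 13]; [:: 2; 5; 7; 8]; [:: 2; 5; 9; 10]; [:: 2; 6; 8; 11];
    [:: 2; 6; 10; 12]; [:: 2; 7; 11; 13]; [:: 2; 9; 11; 12]; [:: 3; 4; 6; 11];
    [:: 3; 4; 7; 10]; [:: 3; 4; 9; 13]; [:: 3; 5; 6; 12]; [:: 3; 5; 8; 10]; [:: 3; 5; 11; 13];
    [:: 3; 6; 8; 13]; [:: 3; 7; 8; 12]; [:: 3; 7; 9; 11]; [:: 3; 9; 10; 12]; [:: 4; 5; 6; 7];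
    [:: 4; 5; 8; 9]; [:: 4; 5; 10; 11]; [:: 4; 5; 12; 13]; [:: 4; 6; 8; 10]; [:: 4; 6; 9; 12];
    [:: 4; 7; 11; 12]; [:: 4; 8; 11; 13]; [:: 5; 6; 9; 11]; [:: 5; 7; 9; 13];
    [:: 5; 7; 10; 12]; [:: 5; 8; 11; 12]; [:: 6; 7; 8; 9]; [:: 6; 7; 10; 11];
    [:: 6; 7; 12; 13]; [:: 6; 9; 10; 13]; [:: 7; 8; 10; 13]; [:: 8; 9; 10; 11];
    [:: 8; 9; 12; 13]; [:: 10; 11; 12; 13]].

Definition f14 (a b c : nat) : nat :=
  if a == b then c else if a == c then b else if b == c then a else
  sumn (nth [::] blocks14 (find (fun B => [&& a \in B, b \in B & c \in B]) blocks14))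
    - (a + b + c).

Lemma f14xx a b : f14 a a b = b.
Proof. by rewrite /f14 eqxx. Qed.

Arguments f14 : simpl never.

Lemma step_order14 : step_order 14.
Proof.
have ck : all (fun a => all (fun b => all (fun c =>
    [&& f14 a b c == f14 b a c, f14 a b c == f14 a c b, f14 a b c < 14,
        f14 a b (f14 a b c) == c &
        [&& ~~ odd a, b == a.+1 & c < a] ==> (f14 a b c < a)])
    (iota 0 14)) (iota 0 14)) (iota 0 14).
  by vm_compute.
have chk (a b c : 'I_14) : [&& f14 a b c == f14 b a c, f14 a b c == f14 a c b, f14 a b c < 14,
        f14 a b (f14 a b c) == c & [&& ~~ odd a, b == a.+1 :> nat & c < a] ==> (f14 a b c < a)].
  by move: ck => /allP/(_ _ (mem_iota_ord a))/allP/(_ _ (mem_iota_ord b))/allP/(_ _ (mem_iota_ord c)).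
exists (fun a b c : 'I_14 => inord (f14 a b c)); split.
  split=> [a b c|a b c|a b|a b c].
  - by have /and5P[/eqP->] := chk a b c.
  - by have /and5P[_ /eqP->] := chk a b c.
  - by rewrite f14xx inord_val.
  - by have /and5P[_ _ lt /eqP e _] := chk a b c; rewrite (inordK lt) e inord_val.
move=> a b c oa ba ca; have /and5P[_ _ lt _] := chk a b c.
by rewrite (inordK lt) oa ba eqxx ca.
Qed.

Theorem step_order_inflate12 n : 0 < n -> step_order n.+1 -> step_order (12 * n + 2).
Proof.
move=> n0 sn; rewrite mulnC addnC.
have pos_inj : injective (fun x : 'I_12 => pos12 x).
  have ck : all (fun x => all (fun y => (pos12 x == pos12 y) ==> (x == y)) (iota 0 12)) (iota 0 12).
    by vm_compute.
  move=> x y e.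
  move: ck => /allP/(_ _ (mem_iota_ord x))/allP/(_ _ (mem_iota_ord y)); rewrite e eqxx /= => /eqP.
  exact: ord_inj.
have pos_lt (x : 'I_12) : pos12 x < 12.
  have ck : all (fun x => pos12 x < 12) (iota 0 12) by vm_compute.
  exact: (allP ck _ (mem_iota_ord x)).
apply: (step_order_inflate (card_ord 2) (card_ord 12) (@ord_inj 2) (@ltn_ord 2) pos_inj pos_lt
  isT isT _ _ _ (check_candelabraP c12_check) c12_flat n0 sn step_order14
  (Q := fun x y z => (- (x + y + z))%R)).
- by move=> x y z; congr (- _)%R; ring.
- by move=> x y z; congr (- _)%R; ring.
- by move=> x y z; ring.
Qed.

Arguments c10 : simpl never.

(** * Inflation by a group of odd order *)

Section InflationByThree.

Variables (n : nat).
Hypothesis on : odd n.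
Let W := 'I_n.
Let posV (o : option W) : nat := if o is Some x then (nat_of_ord x).+1 else 0.
Variable F : option W -> option W -> option W -> option W.
Hypotheses (FS : skein F) (Fst : stepped posV F).

Let Q (x y z : 'I_3) : 'I_3 := (- (x + y + z))%R.
Let h := @uncoded 0 2 c10.
Let hC : candelabra h := check_candelabraP c10_check.

Let posG (p : 'I_1 + 'I_3) : nat := if p is inr x then (nat_of_ord x).+1 else 0.

(* Point [Some x] has position [x.+1], so the partner of the deleted point is [x = 0]; a
   later pair [{x, y}] yields the three consecutive pairs [{(x, i), (y, i)}]. *)
Let pos (a : 'I_1 + W * 'I_3) : nat :=
  match a with
  | inl _ => 0
  | inr (x, i) => if x == 0 :> nat then i.+1 else 6 * (x.+1)./2 - 2 + i.*2 + ~~ odd x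
  end.

Let h_same (i j : 'I_3) (u v : 'I_3) : i != j ->
  h (inr (i, u)) (inr (j, u)) (inr (i, v)) = inr (j, v) /\
  h (inr (i, u)) (inr (j, u)) (inr (j, v)) = inr (i, v).
Proof.
move=> ij.
have ck : all (fun i => all (fun j => all (fun u => all (fun v => (i != j) ==>
    (c10 (i, u) (j, u) (i, v) == (j, v)) && (c10 (i, u) (j, u) (j, v) == (i, v)))
    (iota 0 3)) (iota 0 3)) (iota 0 3)) (iota 0 3) by vm_compute.
move: ck => /allP/(_ _ (mem_iota_ord i))/allP/(_ _ (mem_iota_ord j))/allP/(_ _ (mem_iota_ord u))/allP/(_ _ (mem_iota_ord v)).
rewrite (inj_eq (@ord_inj 3)) ij /= => /andP[/eqP e1 /eqP e2].
by rewrite /h /uncoded /= e1 e2 /uncode /= !(ltn_eqF (ltn_ord _)) !inord_val.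
Qed.

Let h_other (i j : 'I_3) (u : 'I_3) (c : 'I_1 + 'I_3 * 'I_3) : i != j ->
  (if c is inr p then (p.1 != i) && (p.1 != j) else true) ->
  if h (inr (i, u)) (inr (j, u)) c is inr p then (p.1 != i) && (p.1 != j) else true.
Proof.
move=> ij.
have ck : all (fun i => all (fun j => all (fun u => all (fun c =>
    [&& i != j, c.1 != i & c.1 != j] ==>
    ((c10 (i, u) (j, u) c).1 != i) && ((c10 (i, u) (j, u) c).1 != j)
     && ((c10 (i, u) (j, u) c).1 <= 3)) (codes 0 2)) (iota 0 3)) (iota 0 3)) (iota 0 3).
  by vm_compute.
move: ck => /allP/(_ _ (mem_iota_ord i))/allP/(_ _ (mem_iota_ord j))/allP/(_ _ (mem_iota_ord u))/allP/(_ _ (mem_code c)).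
rewrite (inj_eq (@ord_inj 3)) ij andTb => ck hc; rewrite /h /uncoded [code (inr (i, u))]/=.
rewrite [code (inr (j, u))]/=; set t := c10 _ _ _ in ck *.
have : ((code c).1 != i) && ((code c).1 != j).
  case: c hc {ck t} => [l|[m v]] /=; last by rewrite !(inj_eq (@ord_inj 3)).
  by rewrite ![3 == _]eq_sym !(ltn_eqF (ltn_ord _)).
move=> /(implyP ck); rewrite /uncode; case: (t.1 =P 3) => // n3 /andP[/andP[ni nj] le3].
have lt3 : t.1 < 3 by rewrite ltn_neqAle le3 andbT; apply/eqP.
by rewrite [(_, _).1]/= -!(inj_eq (@ord_inj 3)) !inordK // ni nj.
Qed.

Let posG_inj : injective posG.
Proof. by move=> [x|x] [y|y] //=; [rewrite (ord1 x) (ord1 y) | case=> /ord_inj->]. Qed.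

(** An odd [y] opens a pair in the order of [F], so a smaller [x] belongs to an earlier pair, over
    which all positions are smaller. *)
Let low_pos (x y : W) (i : 'I_3) m : (x.+1 < y.+1)%N -> odd y ->
  pos (inr (x, i)) < pos (inr (y, m)).
Proof.
move=> xy oy; rewrite /pos /=; have := ltn_ord i.
case: eqP => x0; case: eqP => y0; rewrite ?oy /=; lia.
Qed.

Lemma step_order_inflate3_of_skein : step_order (3 * n + 1).
Proof.
have n0 : 0 < n by case: n on.
have s4 : step_order 4 := step_order_double (isT : ~~ odd 2) step_order2.
have [f [fS fst]] : exists f, skein f /\ stepped posG f.
  apply: step_order_on s4; [by rewrite card_sum !card_ord | exact: posG_inj |].
  by move=> [x|x] //=; rewrite ltnS.
have fcl (r s t : 'I_1) : exists u, f (inl r) (inl s) (inl t) = inl u.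
  by exists 0%R; rewrite !ord1 (skein12 fS).
have QC12 x y z : Q x y z = Q y x z by rewrite /Q; congr (- _)%R; ring.
have QC23 x y z : Q x y z = Q x z y by rewrite /Q; congr (- _)%R; ring.
have QK x y z : Q x y (Q x y z) = z by rewrite /Q; ring.
have iC := inflate_candelabra FS QC12 QC23 QK hC.
set I := inflate F Q h in iC.
pose w0 : W := Ordinal n0.
apply: (@step_order_of _ _ pos _ _ _ (fill I f w0) (fill_skein w0 iC fS fcl)).
- by rewrite card_sum card_prod !card_ord; lia.
- move=> [s|[x i]] [t|[y j]] /=; rewrite ?(ord1 s) ?(ord1 t) //.
  + by case: eqP => // y0; have := ltn_ord y; lia.
  + by case: eqP => // y0; have := ltn_ord x; lia.
  + have [i3 j3] := (ltn_ord i, ltn_ord j).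
    move=> e; have [xy ij] : nat_of_ord x = y /\ nat_of_ord i = j.
      by move: e; case: eqP => x0; case: eqP => y0; lia.
    by rewrite (ord_inj xy) (ord_inj ij).
- move=> [s|[x i]] /=; first by lia.
  by have [i3 xn] := (ltn_ord i, ltn_ord x); case: eqP => x0; move: on; lia.
have pos0 (x : W) (p : 'I_1 + 'I_3) : nat_of_ord x = 0 -> pos (to_group x p) = posG p.
  by move=> x0; case: p => [u|u] //=; rewrite x0.
move=> [s|[x i]] b c // ea eb lt; have i3 := ltn_ord i.
(* The group over 0, the partner of the deleted point, forms with the stem the SQS(4) at positions 0
   to 3. All other pairs lie over some [{x, y}] with [x] odd. *)
case: (posnP x) => x0.
  have {}ea : ~~ odd (posG (inr i)) by rewrite -(pos0 x).
  have [j bj] : exists j, b = to_group x (inr j).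
    case: b eb => [u|[y j]] eb; first by rewrite /= x0 in eb.
    exists j; move: ea eb => /=; rewrite x0 /= => ea.
    case: eqP => y0 eb; last by lia.
    by rewrite /= (_ : y = x) //; apply/ord_inj; rewrite x0.
  have [p cp] : exists p, c = to_group x p.
    case: c lt => [u|[y j']] lt; first by exists (inl u).
    exists (inr j'); move: ea lt => /=; rewrite x0 /= => ea.
    case: eqP => y0 lt; last by lia.
    by rewrite /= (_ : y = x) //; apply/ord_inj; rewrite x0.
  rewrite bj cp; have := fill_to_group I w0 fcl x (inr i) (inr j) p.
  rewrite [to_group x (inr i)]/= => ->; rewrite (pos0 x) // -/(to_group x (inr i)).
  have e : pos (inr (x, i)) = posG (inr i) by rewrite /= x0.
  rewrite e; apply: fst => //.
    by rewrite -(pos0 x) // -bj eb e.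
  by rewrite -(pos0 x) // -cp -e.
have [ox bE] : odd x /\ exists2 y : W, b = inr (y, i) & nat_of_ord y = x.+1.
  move: ea eb => /=; rewrite (gtn_eqF x0) => ea eb.
  have {}ea : odd x by move: ea; lia.
  split=> //; case: b eb => [u|[y j]] /=; first by lia.
  have j3 := ltn_ord j; case: eqP => y0; first by lia.
  move=> e; have [ij yx] : nat_of_ord j = i /\ nat_of_ord y = x.+1 by lia.
  by exists y => //; rewrite (ord_inj ij).
case: bE => y by_ yx; rewrite by_.
have xy : x != y by apply/eqP => e; move: yx; rewrite e; lia.
have crc c' : crossing (inr (x, i) : 'I_1 + W * 'I_3) (inr (y, i)) c' by rewrite /crossing /= xy.
rewrite fill_crossing // /I.
have Flow o : posV o < x.+1 -> posV (F (Some x) (Some y) o) < x.+1.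
  by move=> lo; have /= F1 := @Fst (Some x) (Some y) o; apply: F1; rewrite ?yx ?ox.
pose L := line F x y; have lL : is_line F L by exists x, y.
have [xL yL] : x \in L /\ y \in L by rewrite !mem_line !inE !eqxx orbT.
pose ix : 'I_3 := inord (index x L); pose iy : 'I_3 := inord (index y L).
have lineE := @line_of_inflate _ _ _ F FS Q h (inr (x, i)) (inr (y, i)).
have ixy : ix != iy.
  by have := @apart_encode _ _ _ F L (inr (x, i) : 'I_1 + W * 'I_3) (inr (y, i)) lL xL yL;
    rewrite /= => ->.
have decx v : decode x L (inr (ix, v)) = inr (x, v) :> 'I_1 + W * 'I_3.
  exact: (@encodeK _ _ _ _ x _ lL (inr (x, v)) xL).
have decy v : decode x L (inr (iy, v)) = inr (y, v) :> 'I_1 + W * 'I_3.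
  exact: (@encodeK _ _ _ _ x _ lL (inr (y, v)) yL).
(* [None] has position 0, so the step property of [F] puts the third point of the line before [x];
   hence whatever the line contains besides the groups [x] and [y] comes earlier. *)
have wlow : third F x y < x.
  by have := Flow None isT; rewrite (skein_sym FS (thirdE FS xy)).
have line_low (c' : 'I_1 + W * 'I_3) : on_line L c' ->
    (if c' is inr p then (p.1 != x) && (p.1 != y) else true) ->
    pos (inflate F Q h (inr (x, i)) (inr (y, i)) c') < pos (inr (x, i)).
  move=> cL nc; rewrite (lineE c' L lL xL yL cL (crc c') x) /=.
  have ne : is_true (if encode L c' is inr p then (p.1 != ix) && (p.1 != iy) else true).
    case: c' cL nc => [u|[z v]] //= zL /andP[zx zy].
    have := @apart_encode _ _ _ F L (inr (z, v) : 'I_1 + W * 'I_3) (inr (x, v)) lL zL xL.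
    have := @apart_encode _ _ _ F L (inr (z, v) : 'I_1 + W * 'I_3) (inr (y, v)) lL zL yL.
    by rewrite /= => -> ->; rewrite zx zy.
  move: (@h_other ix iy i (encode L c') ixy ne); case: (h _ _ _) => [u _|[m v] /= /andP[mx my]].
    by rewrite /= (gtn_eqF x0); lia.
  apply: low_pos => //; rewrite ltnS.
  have : nth x L m \in L by rewrite mem_nth // size_line.
  rewrite mem_line !inE => /or3P[] /eqP e; last by rewrite e.
    have := decodeK (S := 'I_1) (G := 'I_3) FS x lL (inr (m, v)); rewrite /= e => -[em].
    by rewrite -em eqxx in mx.
  have := decodeK (S := 'I_1) (G := 'I_3) FS x lL (inr (m, v)); rewrite /= e => -[em].
  by rewrite -em eqxx in my.
case: c lt => [u|[z j]] lt; first exact: line_low.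
have j3 := ltn_ord j.
have [hx hy] := @h_same ix iy i j ixy.
case: (altP (z =P x)) lt => [-> lt|zx lt].
  rewrite (lineE (inr (x, j)) L lL xL yL xL (crc _) x) /= hx decy.
  by move: lt; rewrite /= yx (gtn_eqF x0) /= ox; lia.
case: (altP (z =P y)) lt => [-> lt|zy lt].
  rewrite (lineE (inr (y, j)) L lL xL yL yL (crc _) x) /= hy decx.
  by move: lt; rewrite /= yx (gtn_eqF x0) /= ox; lia.
have zlow : z < x.
  have nzx : nat_of_ord z <> x by move/ord_inj/eqP; apply/negP.
  have nzy : nat_of_ord z <> y by move/ord_inj/eqP; apply/negP.
  by move: lt nzx nzy ox; rewrite /= yx (gtn_eqF x0); case: eqP; lia.
(* With [z] below [x], either the block of [F] has its last point low by [Flow], or it passes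
   through [None] and [z] is on the line. *)
case E: (F (Some x) (Some y) (Some z)) => [t|].
  rewrite (inflate_transversal Q h i i j _ E).
    by apply: low_pos => //; have := Flow (Some z); rewrite E; apply.
  by rewrite xy eq_sym zx eq_sym zy.
apply: line_low; last by rewrite /= zx zy.
have [xyz _ _] := skein_block FS E.
have e : F None (Some x) (Some y) = Some z by rewrite (skein_sym FS xyz).
by rewrite /= mem_line !inE /third e eqxx !orbT.
Qed.

End InflationByThree.

Theorem step_order_inflate3 n : odd n -> step_order n.+1 -> step_order (3 * n + 1).
Proof.
move=> on sn.
have [F [FS Fst]] : exists F : option 'I_n -> _, skein F /\
    stepped (fun o => if o is Some x then (nat_of_ord x).+1 else 0) F.
  apply: step_order_on sn.
  - by rewrite card_option card_ord.
  - by move=> [x|] [y|] //= [] /ord_inj->.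
  - by move=> [x|] //=; rewrite ltnS.
exact: (step_order_inflate3_of_skein on FS Fst).
Qed.

(** * The recursion on the order *)

Lemma step_order_all q : (q %% 6 = 2 \/ q %% 6 = 4) -> step_order q.
Proof.
elim/ltn_ind: q => q IH q6.
have IHv v : v < q -> (v %% 6 = 2 \/ v %% 6 = 4) -> step_order v by move=> *; apply: IH.
case: (q =P 2) => [->|q2]; first exact: step_order2.
case: (boolP (q %% 4 == 0)) => q4.
  have -> : q = (q %/ 2).*2 by lia.
  by apply: step_order_double; last apply: IHv; lia.
case: (boolP ((q %% 24 == 2) || (q %% 24 == 10))) => q24.
  have [n qn] : exists n, q = 4 * n.*2 + 2 by exists (q %/ 8); lia.
  by rewrite qn; apply: step_order_quadruple; last apply: IHv; lia.
case: (boolP ((q %% 72 == 22) || (q %% 72 == 46))) => q72.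
  have [n qn] : exists n, q = 3 * n + 1 by exists (q %/ 3); lia.
  by rewrite qn; apply: step_order_inflate3; last apply: IHv; lia.
(* For [q = 14] this is [n = 1]: the system of order 2 is inflated, and the explicit system of order
   14 fills the only group. *)
case: (boolP ((q %% 72 == 14) || (q %% 72 == 38))) => q72'.
  have [n qn] : exists n, q = 12 * n + 2 by exists (q %/ 12); lia.
  by rewrite qn; apply: step_order_inflate12; last apply: IHv; lia.
(* The residues left are 62 and 70, where inflation by 12, resp. by 3, would start from an order
   divisible by 6. Tripling with a stem of 2, resp. 4, starts from an order that is 4, resp. 2,
   modulo 6. *)
case: (boolP (q %% 72 == 62)) => q62.
  have [r qr] : exists r, q = 3 * (6 * r + 2) + 2 by exists (q %/ 18); lia.
  by rewrite qr; apply: step_order_triple; last apply: IHv; lia.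
have [r qr] : exists r, q = 3 * (6 * r + 4) + 4 by exists ((q - 16) %/ 18); lia.
by rewrite qr; apply: step_order_triple; last apply: IHv; lia.
Qed.

Theorem theorem3p3 (q : nat) :
  4 <= q -> (q %% 6 = 2 \/ q %% 6 = 4) ->
  exists (S : {set {set 'I_q}}) (L : {perm 'I_q}),
    is_SQS S /\ step_property S L.
Proof. by move=> _ q6; apply/step_order_SQS/step_order_all. Qed.
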